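(* Let $L,R$ be a partition of $[n]$ and let ${\bf d}=(d_1,\ldots,d_n)$ be a vector of nonnegative integers with $\sum_{i=1}^n d_i$ even, $d_{\max}=o(M({\bf d})^{1/4})$ and $M_1({\bf d},R)\ge M_1({\bf d},L)$. Then, uniformly over all $L$ and ${\bf d}$, as $n\to\infty$, $$g(L,R,{\bf d})=\frac{M_1({\bf d},R)!\,e^{-\mu_0({\bf d})-\mu_1({\bf d})-\mu_2({\bf d})}}{2^{(M_1({\bf d},R)-M_1({\bf d},L))/2}\big((M_1({\bf d},R)-M_1({\bf d},L))/2\big)!\prod_{i=1}^n d_i!}\left(1+O\left(\frac{d_{\max}^4}{M({\bf d})}\right)\right).$$
   Context: A B-graph with vertex bipartition $(L,R)$ is a simple graph on vertex set $L\cup R$ (here $L\cup R=[n]$) in which $L$ is an independent set. $g(L,R,{\bf d})$ is the number of B-graphs with vertex bipartition $(L,R)$ in which vertex $i$ has degree $d_i$ for every $i\in[n]$. Notation: $M({\bf d})=\sum_{i=1}^n d_i$, $d_{\max}=\max_i d_i$; for $S\subseteq[n]$, $M_1({\bf d},S)=\sum_{i\in S}d_i$ and $M_2({\bf d},S)=\sum_{i\in S}d_i(d_i-1)$; $\mu_0({\bf d})=\frac{(M_1({\bf d},R)-M_1({\bf d},L))M_2({\bf d},R)}{2M_1({\bf d},R)^2}$, $\mu_1({\bf d})=\frac{M_2({\bf d},R)M_2({\bf d},L)}{2M_1({\bf d},R)^2}$, $\mu_2({\bf d})=\mu_0({\bf d})^2$. ''Uniformly'' means the constant implicit in $O(\cdot)$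 depends only on the function implicit in the $o(\cdot)$ hypothesis, not on the particular choice of $L$ and ${\bf d}$. *)

(* Defs.v *)
From mathcomp Require Import all_boot all_order all_algebra.
From mathcomp Require Import all_classical all_reals all_analysis.

Set Implicit Arguments.
Unset Strict Implicit.
Unset Printing Implicit Defensive.

Import Order.TTheory GRing.Theory Num.Theory.
Import numFieldNormedType.Exports.

Local Open Scope nat_scope.

(* A graph on the vertex set V is represented by its set of edges, an edge
   being a set of vertices. *)
Definition simple_graph (V : finType) (G : {set {set V}}) : bool :=
  [forall e in G, #|e| == 2].

Definition independent (V : finType) (G : {set {set V}}) (S : {set V}) : bool :=
  [forall e in G, ~~ (e \subset S)].

Definition degree (V : finType) (G : {set {set V}}) (v : V) : nat :=
  #|[set e in G | v \in e]%SET|.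

(* Either part may be empty, unlike the blocks in finset's [partition]. *)
Definition bipartition (V : finType) (L R : {set V}) : bool :=
  [disjoint L & R] && (L :|: R == [set: V])%SET.

Definition Bgraph (V : finType) (L R : {set V}) (G : {set {set V}}) : bool :=
  [&& bipartition L R, simple_graph G & independent G L].

Definition num_Bgraphs (n : nat) (L R : {set 'I_n}) (d : 'I_n -> nat) : nat :=
  #|[set G : {set {set 'I_n}}
      | Bgraph L R G && [forall i, degree G i == d i]]%SET|.

Definition M (n : nat) (d : 'I_n -> nat) : nat := \sum_(i < n) d i.

Definition dmax (n : nat) (d : 'I_n -> nat) : nat := \max_(i < n) d i.

Definition M1 (n : nat) (d : 'I_n -> nat) (S : {set 'I_n}) : nat :=
  \sum_(i in S) d i.

Definition M2 (n : nat) (d : 'I_n -> nat) (S : {set 'I_n}) : nat :=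
  \sum_(i in S) d i * (d i - 1).

Local Open Scope ring_scope.

(* If M1 d R = 0, which under M1 d L <= M1 d R forces d = 0, the numerators
   vanish as well and the quotients 0 / 0 are 0. *)
Definition mu0 (K : realType) (n : nat) (L R : {set 'I_n}) (d : 'I_n -> nat)
    : K :=
  ((M1 d R)%:R - (M1 d L)%:R) * (M2 d R)%:R / (2 * (M1 d R)%:R ^+ 2).

Definition mu1 (K : realType) (n : nat) (L R : {set 'I_n}) (d : 'I_n -> nat)
    : K :=
  (M2 d R)%:R * (M2 d L)%:R / (2 * (M1 d R)%:R ^+ 2).

Definition mu2 (K : realType) (n : nat) (L R : {set 'I_n}) (d : 'I_n -> nat)
    : K :=
  mu0 K L R d ^+ 2.

(* The number of edges inside R.  The truncated subtraction and the integer
   division are exact when M1 d L <= M1 d R and the sum of d is even. *)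
Definition RR_edges (n : nat) (L R : {set 'I_n}) (d : 'I_n -> nat) : nat :=
  ((M1 d R - M1 d L) %/ 2)%N.

Definition main_term (K : realType) (n : nat) (L R : {set 'I_n})
    (d : 'I_n -> nat) : K :=
  (M1 d R)`!%:R * expR (- mu0 K L R d - mu1 K L R d - mu2 K L R d)
  / (2 ^+ RR_edges L R d * (RR_edges L R d)`!%:R * \prod_(i < n) (d i)`!%:R).

(* Main.v *)
(* Subdivide each of the k = (M1 d R - M1 d L) / 2 edges inside R by a dummy
   vertex of degree 2, placed on the left.  Both sides then have N = M1 d R
   points, and a B-graph with degrees d comes from exactly
   2^k k! prod_(i in L) d_i! assignments rho of the left points to the vertices
   of R (each vertex v receiving d_v points) that avoid two kinds of events:
     - two points of the same left vertex go to the same vertex of R;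
     - two dummies join the same pair of vertices of R.
   There are N! / prod_(i in R) d_i! assignments altogether.  Expose the events
   one at a time.  To estimate the probability of an event that equates t pairs
   of points (t = 1 or 2), given that no earlier event occurs, exchange its 2t
   points with 2t other points in all possible ways: few exchanges create an
   earlier event, so the probability is q^t with q = M2 d R / N^2, up to errors
   that add up to O(d_max^4 / N) over all events.  If n1 and n2 count the events
   of the two kinds, the probability of avoiding all of them is therefore
   exp (- n1 q - n2 q^2 + O(d_max^4 / N)) with n1 q = mu0 + mu1 and
   n2 q^2 = mu2 + O(d_max^2 / N). *)
Require Import Defs.
From mathcomp Require Import all_boot all_order all_algebra.
From mathcomp Require Import all_classical all_reals all_analysis.
From mathcomp Require Import zify ring lra.
From mathcomp Require Import fintype finset.

Set Implicit Arguments.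
Unset Strict Implicit.
Unset Printing Implicit Defensive.

Import Order.TTheory GRing.Theory Num.Theory.
Import numFieldNormedType.Exports.

(** * Swapping points of an assignment *)

Section Swap.
Variables (U : eqType).
Implicit Types (us ws : seq U).

Definition swap us ws (x : U) : U :=
  if x \in us then nth x ws (index x us)
  else if x \in ws then nth x us (index x ws) else x.

Lemma swap_in us ws x : size us = size ws -> x \in us -> swap us ws x \in ws.
Proof. by move=> sz xus; rewrite /swap xus mem_nth // -sz index_mem. Qed.

Lemma swap_out us ws x : x \notin us -> x \notin ws -> swap us ws x = x.
Proof. by rewrite /swap => /negbTE-> /negbTE->. Qed.

Lemma swapK us ws : size us = size ws -> uniq (us ++ ws) ->
  involutive (swap us ws).
Proof.
move=> sz; rewrite cat_uniq => /and3P[us_uniq /hasPn dis ws_uniq] x.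
have [xus|xus] := boolP (x \in us).
  have iw : index x us < size ws by rewrite -sz index_mem.
  have sw : swap us ws x = nth x ws (index x us) by rewrite /swap xus.
  have wws : nth x ws (index x us) \in ws by rewrite mem_nth.
  rewrite sw /swap (negbTE (dis _ wws)) wws index_uniq //.
  by rewrite (set_nth_default x) ?nth_index // index_mem.
have [xws|xws] := boolP (x \in ws); last by rewrite !swap_out.
have iw : index x ws < size us by rewrite sz index_mem.
have sw : swap us ws x = nth x us (index x ws) by rewrite /swap (negbTE xus) xws.
have wus : nth x us (index x ws) \in us by rewrite mem_nth.
rewrite sw /swap wus index_uniq //.
by rewrite (set_nth_default x) ?nth_index // index_mem.
Qed.

Lemma swap_nth us ws x0 i : size us = size ws -> uniq (us ++ ws) ->
  i < size us -> swap us ws (nth x0 us i) = nth x0 ws i.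
Proof.
move=> sz; rewrite cat_uniq => /andP[us_uniq _] i_lt.
rewrite /swap mem_nth // index_uniq //.
by apply: set_nth_default; rewrite -sz.
Qed.

Lemma swap_nthV us ws x0 i : size us = size ws -> uniq (us ++ ws) ->
  i < size us -> swap us ws (nth x0 ws i) = nth x0 us i.
Proof. by move=> sz un i_lt; rewrite -(swap_nth x0 sz un i_lt) swapK. Qed.

End Swap.

Section Safe.
Variables (U V : finType) (m : U -> U) (E : rel U).
Hypotheses (mK : involutive m) (E_sym : symmetric E).
Implicit Types (rho : {ffun U -> V}) (us ws : seq U) (u v w p q : U) (B : rel U).

Definition avoid1 B rho := [forall p, forall q, B p q ==> (rho p != rho q)].

Definition avoid2 B rho := [forall p, forall q,
  B p q ==> ~~ ((rho p == rho q) && (rho (m p) == rho (m q)))].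

Lemma avoid1P B rho :
  reflect (forall p q, B p q -> rho p <> rho q) (avoid1 B rho).
Proof.
apply: (iffP 'forall_forallP) => h p q; last by apply/implyP => /h/eqP.
by move=> Bpq; apply/eqP; move/implyP: (h p q); apply.
Qed.

Lemma avoid2P B rho :
  reflect (forall p q, B p q -> rho p = rho q -> rho (m p) <> rho (m q))
          (avoid2 B rho).
Proof.
apply: (iffP 'forall_forallP) => h p q.
  move=> Bpq e1 e2; move/implyP: (h p q) => /(_ Bpq).
  by rewrite e1 e2 !eqxx.
by apply/implyP => /h nh; apply/negP => /andP[/eqP/nh h1 /eqP/h1].
Qed.

(* Exchanging w with a point u of the event being created or destroyed cannot
   affect the other events unless sbad rho u w; two points w, v exchanged at the
   same time cannot do so jointly unless pbad rho w v. *)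
Definition sbad rho u w :=
  [|| w == u, m w == u, E u w, rho w == rho u, rho (m w) == rho u,
      [exists q, E u q && (rho q == rho w)],
      [exists q, (rho q == rho u) && E q w] |
      [exists q, (rho q == rho u) && (rho (m q) == rho (m w))]].

Definition pbad rho w v :=
  [|| w == v, m w == v, E w v, rho w == rho v, rho (m w) == rho (m v) |
      [exists q, (rho q == rho w) && (rho (m q) == rho v)]].

Definition swapf us ws rho : {ffun U -> V} := [ffun x => rho (swap us ws x)].

Section Main.
Variables (B1 B2 : rel U) (rho : {ffun U -> V}) (us ws : seq U).
Hypotheses (B1_sym : symmetric B1) (B1E : subrel B1 E)
  (B2_sym : symmetric B2) (B2m : forall p q, B2 p q -> B2 (m p) (m q))
  (B2B1 : forall p q, B2 p q -> B1 p (m p)).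
Hypotheses (sz : size us = size ws) (us_ws : uniq (us ++ ws))
  (us_m : forall p q, B2 p q -> p \in us -> m p \in us)
  (singles : forall u w, u \in us -> w \in ws -> ~~ sbad rho u w)
  (* The second alternative is for points u, v that the exchange equates on
     purpose, by an event not yet in B1, B2. *)
  (pairs : forall u v, u \in us -> v \in us -> u <> v ->
     ~~ pbad rho (swap us ws u) (swap us ws v) \/
     [/\ rho (swap us ws u) = rho (swap us ws v), ~~ B1 u v & ~~ B2 u v]).
Hypotheses (av1 : avoid1 B1 rho) (av2 : avoid2 B2 rho).

Let pi := swap us ws.

Let piK : involutive pi. Proof. exact: swapK. Qed.

Let pi_us p : p \in us -> pi p \in ws. Proof. exact: swap_in. Qed.

Let pi_ws p : p \in ws -> exists2 u, u \in us & p = pi u.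
Proof.
move=> pws; exists (pi p); last by rewrite piK.
rewrite /pi /swap pws; case: ifP => [pus|_]; last by rewrite mem_nth // sz index_mem.
by move: us_ws; rewrite cat_uniq => /and3P[_ /hasPn /(_ _ pws)]; rewrite pus.
Qed.

Let pi_out p : p \notin us -> p \notin ws -> pi p = p.
Proof. exact: swap_out. Qed.

Let disj p : p \in us -> p \in ws -> False.
Proof.
by move=> pus pws; move: us_ws; rewrite cat_uniq => /and3P[_ /hasPn /(_ _ pws)]; rewrite pus.
Qed.

Lemma swapf_avoid1 : avoid1 B1 (swapf us ws rho).
Proof.
apply/avoid1P => p q; rewrite !ffunE -!/(pi _).
move/avoid1P: av1 => a1.
have step p' q' : B1 p' q' -> p' \in us -> rho (pi p') <> rho (pi q').
  move=> B pus e; have ne : p' <> q' by move=> ee; subst; apply: a1 B _.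
  have [qus|qus] := boolP (q' \in us).
    have [pb|[_ nB _]] := pairs pus qus ne; last by rewrite B in nB.
    by move: pb; rewrite /pbad -!/(pi _) e eqxx !orbT.
  have [qws|qws] := boolP (q' \in ws).
    by have := singles pus qws; rewrite /sbad (B1E B) !orbT.
  rewrite (pi_out qus qws) in e.
  have := singles pus (pi_us pus); rewrite /sbad.
  suff -> : [exists q, E p' q && (rho q == rho (pi p'))] by rewrite !orbT.
  by apply/existsP; exists q'; rewrite (B1E B) e eqxx.
move=> B e.
have [pus|pus] := boolP (p \in us); first exact: step B pus e.
have [qus|qus] := boolP (q \in us).
  by apply: (step q p _ qus (esym e)); rewrite B1_sym.
have stepw p' q' : B1 p' q' -> p' \in ws -> q' \notin us -> rho (pi p') <> rho (pi q').
  move=> {}B pws {}qus {}e.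
  have [u uus pu] := pi_ws pws.
  have [qws|qws] := boolP (q' \in ws).
    have [v vus qv] := pi_ws qws.
    have ne : u <> v by move=> ee; subst; apply: a1 B _.
    have [pb|[re _ _]] := pairs uus vus ne.
      by move: pb; rewrite /pbad -!/(pi _) -pu -qv (B1E B) !orbT.
    by apply: a1 B _; rewrite pu qv.
  rewrite (pi_out qus qws) pu piK in e.
  have := singles uus pws; rewrite /sbad.
  suff -> : [exists q, (rho q == rho u) && E q p'] by rewrite !orbT.
  by apply/existsP; exists q'; rewrite e eqxx E_sym (B1E B).
have [pws|pws] := boolP (p \in ws); first exact: stepw B pws qus e.
have [qws|qws] := boolP (q \in ws).
  by apply: (stepw q p _ qws pus (esym e)); rewrite B1_sym.
by rewrite (pi_out pus pws) (pi_out qus qws) in e; apply: a1 B e.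
Qed.

Lemma swapf_avoid2 : avoid2 B2 (swapf us ws rho).
Proof.
apply/avoid2P => p q B; rewrite !ffunE -!/(pi _) => e1 e2.
move/avoid1P: av1 => a1; move/avoid2P: av2 => a2.
have B1m p' q' : B2 p' q' -> rho p' <> rho (m p') by move=> /B2B1 /a1.
have usm p' q' : B2 p' q' -> p' \notin us -> m p' \notin us.
  move=> {}B pus; apply/negP => mus; move/negP: pus; apply.
  by rewrite -(mK p'); apply: us_m (B2m B) mus.
have wsm p' q' : B2 p' q' -> p' \in ws -> m p' \notin ws.
  move=> {}B pws; apply/negP => mws.
  have [u uus pu] := pi_ws pws; have [v vus pv] := pi_ws mws.
  have ne : u <> v by move=> ee; apply: (B1m _ _ B); rewrite pv -ee -pu.
  have [pb|[re _ _]] := pairs uus vus ne.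
    by move: pb; rewrite /pbad -!/(pi _) -pu -pv eqxx !orbT.
  by apply: (B1m _ _ B); rewrite pv pu.
have stepU p' q' : B2 p' q' -> p' \in us ->
    rho (pi p') = rho (pi q') -> rho (pi (m p')) <> rho (pi (m q')).
  move=> {}B pus {}e1 {}e2.
  have mpus : m p' \in us by exact: us_m B pus.
  have ne : p' <> q' by move=> ee; subst; apply: a2 B _ _.
  have [qus|qus] := boolP (q' \in us).
    have [pb|[_ _ nB]] := pairs pus qus ne; last by rewrite B in nB.
    by move: pb; rewrite /pbad -!/(pi _) e1 eqxx !orbT.
  have Bs : B2 q' p' by rewrite B2_sym.
  have mqus := usm _ _ Bs qus.
  have [qws|qws] := boolP (q' \in ws).
    have [u uus qu] := pi_ws qws; rewrite qu piK in e1.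
    have := singles uus (pi_us pus).
    by rewrite /sbad e1 eqxx !orbT.
  have [mqws|mqws] := boolP (m q' \in ws).
    have [u uus qu] := pi_ws mqws; rewrite qu piK in e2.
    have := singles uus (pi_us mpus).
    by rewrite /sbad e2 eqxx !orbT.
  rewrite (pi_out qus qws) in e1; rewrite (pi_out mqus mqws) in e2.
  have nem : p' <> m p' by move=> ee; apply: (B1m _ _ B); rewrite -ee.
  have [pb|[_ nB _]] := pairs pus mpus nem; last by rewrite (B2B1 B) in nB.
  move: pb; rewrite /pbad -!/(pi _).
  suff -> : [exists q0, (rho q0 == rho (pi p')) && (rho (m q0) == rho (pi (m p')))]
    by rewrite !orbT.
  by apply/existsP; exists q'; rewrite e1 e2 !eqxx.
have [pus|pus] := boolP (p \in us); first exact: stepU B pus e1 e2.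
have Bs : B2 q p by rewrite B2_sym.
have [qus|qus] := boolP (q \in us); first exact: stepU Bs qus (esym e1) (esym e2).
have stepW p' q' : B2 p' q' -> p' \in ws -> q' \notin us ->
    rho (pi p') = rho (pi q') -> rho (pi (m p')) <> rho (pi (m q')).
  move=> {}B pws {}qus {}e1 {}e2.
  have {}Bs : B2 q' p' by rewrite B2_sym.
  have mqus := usm _ _ Bs qus.
  have [u uus pu] := pi_ws pws.
  have mpus : m p' \notin us.
    by apply: usm B _; apply/negP => pus'; exact: disj pus' pws.
  have mpws := wsm _ _ B pws.
  rewrite (pi_out mpus mpws) in e2; rewrite pu piK in e1.
  have [qws|qws] := boolP (q' \in ws).
    have [v vus qv] := pi_ws qws.
    have ne : u <> v by move=> ee; subst; apply: a2 B _ _.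
    rewrite (pi_out mqus (wsm _ _ Bs qws)) in e2.
    have [pb|[re _ _]] := pairs uus vus ne.
      by move: pb; rewrite /pbad -!/(pi _) -pu -qv e2 eqxx !orbT.
    by apply: a2 B _ e2; rewrite pu qv.
  rewrite (pi_out qus qws) in e1.
  have [mqws|mqws] := boolP (m q' \in ws).
    have := singles uus mqws; rewrite /sbad mK.
    by rewrite e1 eqxx !orbT.
  rewrite (pi_out mqus mqws) in e2.
  have := singles uus pws; rewrite /sbad.
  suff -> : [exists q, (rho q == rho u) && (rho (m q) == rho (m p'))] by rewrite !orbT.
  by apply/existsP; exists q'; rewrite e1 e2 !eqxx.
have [pws|pws] := boolP (p \in ws); first exact: stepW B pws qus e1 e2.
have [qws|qws] := boolP (q \in ws); first exact: stepW Bs qws pus (esym e1) (esym e2).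
have mpus := usm _ _ B pus; have mqus := usm _ _ Bs qus.
have [mpws|mpws] := boolP (m p \in ws).
  by apply: stepW (B2m B) mpws mqus e2 _; rewrite !mK.
have [mqws|mqws] := boolP (m q \in ws).
  by apply: stepW (B2m Bs) mqws mpus (esym e2) _; rewrite !mK.
rewrite (pi_out pus pws) (pi_out qus qws) in e1.
rewrite (pi_out mpus mpws) (pi_out mqus mqws) in e2.
exact: a2 B e1 e2.
Qed.

End Main.
End Safe.

(** * Conditional probability of a single event *)

Section Counting.

Lemma card_set_or (X : finType) (P Q : pred X) :
  #|[set x | P x || Q x]| <= #|[set x | P x]| + #|[set x | Q x]|.
Proof.
have -> : [set x | P x || Q x] = [set x | P x] :|: [set x | Q x].
  by apply/setP => x; rewrite !inE.
exact: leq_card_setU.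
Qed.

Lemma card_set_or_le (X : finType) (P Q : pred X) s t :
  #|[set x | P x]| <= s -> #|[set x | Q x]| <= t ->
  #|[set x | P x || Q x]| <= s + t.
Proof. by move=> Ps Qt; apply: leq_trans (card_set_or P Q) (leq_add Ps Qt). Qed.

Lemma card_pairs (X Y : finType) (A : pred X) (P : X -> pred Y) :
  #|[set z : X * Y | A z.1 && P z.1 z.2]| = \sum_(x | A x) #|[set y | P x y]|.
Proof.
rewrite -sum1_card (eq_bigl (fun z : X * Y => A z.1 && P z.1 z.2)); last first.
  by move=> z; rewrite inE.
rewrite -(pair_big_dep A P (fun _ _ => 1)) /=.
apply: eq_bigr => x Ax; rewrite -[RHS]sum1_card.
by rewrite [RHS](eq_bigl (P x)) // => y; rewrite inE.
Qed.

Lemma card_pairs_le (X Y : finType) (A : pred X) (P : X -> pred Y) D :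
  (forall x, A x -> #|[set y | P x y]| <= D) ->
  #|[set z : X * Y | A z.1 && P z.1 z.2]| <= #|[set x | A x]| * D.
Proof.
move=> PD; rewrite card_pairs -sum_nat_const.
by rewrite [leqRHS](eq_bigl A); [exact: leq_sum | move=> x; rewrite inE].
Qed.

Lemma card_proj_le (W X Y : finType) (g : W -> X * Y) (P : pred X) :
  injective g -> #|[set z | P (g z).1]| <= #|[set x | P x]| * #|Y|.
Proof.
move=> ginj; rewrite -(card_imset _ ginj).
rewrite -cardsT -cardsX; apply: subset_leq_card.
by apply/subsetP => y /imsetP[z]; rewrite !inE => Pz ->; rewrite Pz.
Qed.

Lemma card_exists_le (X Y : finType) (A : pred X) (P : X -> pred Y) D :
  (forall x, A x -> #|[set y | P x y]| <= D) ->
  #|[set y | [exists x, A x && P x y]]| <= #|[set x | A x]| * D.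
Proof.
move=> /card_pairs_le; apply: leq_trans.
pose Z := [set z : X * Y | A z.1 && P z.1 z.2].
apply: leq_trans (leq_imset_card snd Z); apply: subset_leq_card.
apply/subsetP => y; rewrite inE => /existsP[x Axy].
by apply/imsetP; exists (x, y); rewrite ?inE.
Qed.

Lemma double_count (X W : finType) (S1 S2 : {set X}) (P1 P2 : X -> {set W})
    (f : W -> X -> X) c1 c2 :
  (forall s w, s \in S1 -> w \in P1 s ->
     [/\ f w s \in S2, w \in P2 (f w s) & f w (f w s) = s]) ->
  (forall s, s \in S1 -> c1 <= #|P1 s|) ->
  (forall s, s \in S2 -> #|P2 s| <= c2) ->
  #|S1| * c1 <= #|S2| * c2.
Proof.
move=> fP c1P c2P.
pose Z1 := [set z : X * W | (z.1 \in S1) && (z.2 \in P1 z.1)].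
pose Z2 := [set z : X * W | (z.1 \in S2) && (z.2 \in P2 z.1)].
pose g (z : X * W) := (f z.2 z.1, z.2).
have Z12 : #|Z1| <= #|Z2|.
  have ginj : {in Z1 &, injective g}.
    move=> [s w] [s' w']; rewrite !inE /= => /andP[sS sw] /andP[sS' sw'].
    case=> e ew; rewrite -ew in e sw'; rewrite -ew; congr (_, _).
    have [_ _ <-] := fP _ _ sS sw; have [_ _ {1}<-] := fP _ _ sS' sw'.
    by rewrite e.
  rewrite -(card_in_imset ginj); apply: subset_leq_card; apply/subsetP => y.
  case/imsetP => [[s w]]; rewrite !inE /= => /andP[sS sw] ->.
  by have [-> -> _] := fP _ _ sS sw.
apply: leq_trans (leq_trans Z12 _).
  rewrite /Z1 (card_pairs (mem S1) (fun s => mem (P1 s))) -sum_nat_const.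
  apply: leq_sum => s /c1P /leq_trans; apply; apply: subset_leq_card.
  by apply/subsetP => w; rewrite inE.
rewrite /Z2 (card_pairs (mem S2) (fun s => mem (P2 s))) -sum_nat_const.
apply: leq_sum => s /c2P; apply: leq_trans; apply: subset_leq_card.
by apply/subsetP => w; rewrite inE.
Qed.

End Counting.

Section Ratio.
Variables (U V : finType) (m : U -> U) (E : rel U) (a : V -> nat) (d : nat).
Hypotheses (mK : involutive m) (E_sym : symmetric E) (d_gt0 : 0 < d)
  (a_le : forall v, a v <= d) (E_le : forall u, #|[set v | E u v]| <= d).
Implicit Types (rho : {ffun U -> V}) (us ws : seq U) (u v w p q : U) (B : rel U).

Definition assignments : {set {ffun U -> V}} :=
  [set rho : {ffun U -> V} | [forall v, #|[set u | rho u == v]| == a v]].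

Definition good_assignments B1 B2 :=
  [set rho in assignments | avoid1 B1 rho && avoid2 m B2 rho].

Let N := #|U|.
Definition num_pairs := \sum_v a v * (a v - 1).
Let Q := num_pairs.

Lemma swapf_assignments us ws rho : size us = size ws -> uniq (us ++ ws) ->
  rho \in assignments -> swapf us ws rho \in assignments.
Proof.
move=> sz un; rewrite !inE => /forallP h; apply/forallP => v.
rewrite -(eqP (h v)).
have sinj : injective (swap us ws) by apply: inv_inj; exact: swapK.
rewrite -(card_preimset [set u | rho u == v] sinj); apply/eqP/eq_card => u.
by rewrite !inE ffunE.
Qed.

Lemma swapfK us ws rho : size us = size ws -> uniq (us ++ ws) ->
  swapf us ws (swapf us ws rho) = rho.
Proof. by move=> sz un; apply/ffunP => x; rewrite !ffunE swapK. Qed.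

Lemma card_fiber_le rho (x : V) : rho \in assignments ->
  #|[set u | rho u == x]| <= d.
Proof. by rewrite inE => /forallP /(_ x) /eqP ->. Qed.

Lemma card_preim_inj_le (P : pred U) (f : U -> U) D :
  injective f -> #|[set u | P u]| <= D -> #|[set u | P (f u)]| <= D.
Proof.
move=> finj; apply: leq_trans; rewrite -(card_preimset [set u | P u] finj).
by apply: subset_leq_card; apply/subsetP => u; rewrite !inE.
Qed.

Lemma card_eq1 u : #|[set w | w == u]| <= 1.
Proof. by rewrite -(cards1 u); apply: subset_leq_card; apply/subsetP => w; rewrite !inE. Qed.

Let m_inj : injective m. Proof. exact: inv_inj. Qed.

Let leq_sqr x : x <= d -> x <= d ^ 2. Proof. move: d_gt0; nia. Qed.

Let fib_mul rho (x : V) : rho \in assignments ->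
  #|[set q | rho q == x]| * d <= d ^ 2.
Proof. by move=> rA; have := card_fiber_le x rA; move: d_gt0; nia. Qed.

Lemma card_sbad rho u : rho \in assignments ->
  #|[set w | sbad m E rho u w]| <= 8 * d ^ 2.
Proof.
move=> rA.
have h1 := card_eq1 u; have h2 := card_preim_inj_le m_inj h1.
have h3 := leq_sqr (E_le u).
have h4 := leq_sqr (card_fiber_le (rho u) rA).
have h5 := leq_sqr (card_preim_inj_le m_inj (card_fiber_le (rho u) rA)).
have h6 : #|[set w | [exists q, E u q && (rho q == rho w)]]| <= d ^ 2.
  apply: leq_trans (_ : _ <= #|[set q | E u q]| * d) _.
    apply: card_exists_le => q _.
    by under eq_finset do rewrite eq_sym; apply: card_fiber_le.
  by move: d_gt0 (E_le u); nia.
have h7 : #|[set w | [exists q, (rho q == rho u) && E q w]]| <= d ^ 2.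
  apply: leq_trans (fib_mul (rho u) rA).
  by apply: card_exists_le => q _.
have h8 : #|[set w | [exists q, (rho q == rho u) && (rho (m q) == rho (m w))]]| <= d ^ 2.
  apply: leq_trans (fib_mul (rho u) rA).
  apply: card_exists_le => q _.
  apply: (card_preim_inj_le (P := fun w => rho (m q) == rho w) m_inj).
  by under eq_finset do rewrite eq_sym; apply: card_fiber_le.
rewrite /sbad; apply: leq_trans (card_set_or_le h1 (card_set_or_le h2
  (card_set_or_le h3 (card_set_or_le h4 (card_set_or_le h5
  (card_set_or_le h6 (card_set_or_le h7 h8))))))) _.
by move: (leq_sqr d_gt0); lia.
Qed.

Lemma card_pbad rho w : rho \in assignments ->
  #|[set v | pbad m E rho w v]| <= 6 * d ^ 2.
Proof.
move=> rA.
have h1 : #|[set v | w == v]| <= 1.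
  by under eq_finset do rewrite eq_sym; apply: card_eq1.
have h2 : #|[set v | m w == v]| <= 1.
  by under eq_finset do rewrite eq_sym; apply: card_eq1.
have fib x : #|[set v | x == rho v]| <= d.
  by under eq_finset do rewrite eq_sym; apply: card_fiber_le.
have h3 := leq_sqr (E_le w).
have h4 := leq_sqr (fib (rho w)).
have h5 := leq_sqr (card_preim_inj_le m_inj (fib (rho (m w)))).
have h6 : #|[set v | [exists q, (rho q == rho w) && (rho (m q) == rho v)]]| <= d ^ 2.
  by apply: leq_trans (fib_mul (rho w) rA); apply: card_exists_le => q _.
rewrite /pbad; apply: leq_trans (card_set_or_le h1 (card_set_or_le h2
  (card_set_or_le h3 (card_set_or_le h4 (card_set_or_le h5 h6))))) _.
by move: (leq_sqr d_gt0); lia.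
Qed.

Lemma pbadC rho v w : pbad m E rho v w = pbad m E rho w v.
Proof.
rewrite /pbad eq_sym E_sym (eq_sym (rho v)) (eq_sym (rho (m v))).
rewrite (inv_eq mK) (eq_sym v (m w)).
suff h p q : [exists r, (rho r == rho p) && (rho (m r) == rho q)] ->
    [exists r, (rho r == rho q) && (rho (m r) == rho p)].
  by rewrite (_ : [exists r, _] = [exists r, (rho r == rho w) && (rho (m r) == rho v)]) //;
    apply/idP/idP; exact: h.
by case/existsP => r /andP[r1 r2]; apply/existsP; exists (m r); rewrite mK r1 r2.
Qed.

Definition eq_pairs rho : {set U * U} :=
  [set x | (rho x.1 == rho x.2) && (x.1 != x.2)].

Lemma card_eq_pairs rho : rho \in assignments -> #|eq_pairs rho| = Q.
Proof.
rewrite inE => /forallP rA.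
have h u : #|[set v | (rho u == rho v) && (u != v)]| = (a (rho u)).-1.
  have -> : [set v | (rho u == rho v) && (u != v)] = [set v | rho v == rho u] :\ u.
    by apply/setP => v; rewrite !inE andbC (eq_sym u) (eq_sym (rho u)).
  by have := cardsD1 u [set v | rho v == rho u]; rewrite (eqP (rA _)) inE eqxx /= => ->.
have -> : eq_pairs rho =
    [set x : U * U | xpredT x.1 && ((rho x.1 == rho x.2) && (x.1 != x.2))].
  by apply/setP => x; rewrite !inE.
rewrite (card_pairs xpredT (fun u v => (rho u == rho v) && (u != v))).
rewrite (eq_bigr _ (fun u _ => h u)) (partition_big rho xpredT) //=.
apply: eq_bigr => v _; rewrite (eq_bigr (fun=> (a v).-1)); last by move=> u /eqP->.
rewrite sum_nat_const -subn1; congr (_ * _); rewrite -(eqP (rA v)).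
by apply: eq_card => u; rewrite !inE.
Qed.

Lemma card_eq_pairs1_le rho (T : pred U) t : rho \in assignments ->
  #|[set u | T u]| <= t ->
  #|[set x | (x \in eq_pairs rho) && T x.1]| <= t * d.
Proof.
move=> rA Tt; apply: leq_trans (_ : #|[set x : U * U | T x.1 && (rho x.1 == rho x.2)]| <= _).
  by apply: subset_leq_card; apply/subsetP => x; rewrite !inE => /andP[/andP[-> _] ->].
apply: leq_trans (card_pairs_le (A := T) (P := fun u v => rho u == rho v) (D := d) _) _.
  by move=> u _; under eq_finset do rewrite eq_sym; apply: card_fiber_le.
by rewrite leq_mul2r Tt orbT.
Qed.

Lemma card_eq_pairs2_le rho (T : pred U) t : rho \in assignments ->
  #|[set u | T u]| <= t ->
  #|[set x | (x \in eq_pairs rho) && T x.2]| <= t * d.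
Proof.
move=> rA /(card_eq_pairs1_le rA); apply: leq_trans.
pose sw (x : U * U) := (x.2, x.1).
have swinj : injective sw by move=> [x y] [x' y'] [-> ->].
rewrite -(card_imset _ swinj); apply: subset_leq_card; apply/subsetP => y.
case/imsetP => x; rewrite !inE => /andP[/andP[r n] t2] -> /=.
by rewrite eq_sym r t2 eq_sym n.
Qed.


Definition sbad_any rho us w := has (fun u => sbad m E rho u w) us.

Lemma card_sbad_any rho us : rho \in assignments ->
  #|[set w | sbad_any rho us w]| <= size us * (8 * d ^ 2).
Proof.
move=> rA; elim: us => [|u us IH] /=.
  by rewrite mul0n leqn0 cards_eq0; apply/eqP/setP => w; rewrite !inE.
by rewrite mulSn; apply: card_set_or_le IH; apply: card_sbad.
Qed.

Lemma sbad_any_notin rho us w : ~~ sbad_any rho us w -> w \notin us.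
Proof.
by move=> /hasPn h; apply/negP => /h; rewrite /sbad eqxx.
Qed.

Lemma sbad_anyP rho us ws : ~~ has (sbad_any rho us) ws ->
  forall u w, u \in us -> w \in ws -> ~~ sbad m E rho u w.
Proof. by move=> /hasPn h u w uus /h /hasPn; apply. Qed.

Lemma good_assignmentsP B1 B2 rho :
  reflect [/\ rho \in assignments, avoid1 B1 rho & avoid2 m B2 rho]
          (rho \in good_assignments B1 B2).
Proof. by rewrite [X in reflect _ X]inE; apply: and3P. Qed.

Section Loops.
Variables (B1 : rel U) (u1 u2 : U).
Hypotheses (B1_sym : symmetric B1) (B1E : subrel B1 E)
  (u12 : u1 != u2) (u12_new : ~~ B1 u1 u2).

Let none : rel U := fun _ _ => false.
Let us := [:: u1; u2].

Lemma swap2_good rho w1 w2 : rho \in good_assignments B1 none ->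
  ~~ sbad_any rho us w1 -> ~~ sbad_any rho us w2 ->
  ~~ pbad m E rho w1 w2 \/ (w1, w2) \in eq_pairs rho ->
  uniq (us ++ [:: w1; w2]) /\
  swapf us [:: w1; w2] rho \in good_assignments B1 none.
Proof.
case/good_assignmentsP => rA av1 av2 s1 s2 pr.
have n1 := sbad_any_notin s1; have n2 := sbad_any_notin s2.
have w12 : w1 != w2.
  by case: pr => [|]; [rewrite /pbad; case/norP | rewrite inE => /andP[]].
have un : uniq (us ++ [:: w1; w2]).
  move: n1 n2; rewrite /= !inE !negb_or u12 w12 !(eq_sym _ u1) !(eq_sym _ u2).
  by move=> /andP[-> ->] /andP[-> ->].
have sw1 := swap_nth u1 (erefl : size us = size [:: w1; w2]) un (erefl : 0 < 2).
have sw2 := swap_nth u1 (erefl : size us = size [:: w1; w2]) un (erefl : 1 < 2).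
rewrite /= in sw1 sw2; split=> //.
apply/good_assignmentsP; split.
- exact: swapf_assignments.
- apply: (@swapf_avoid1 _ _ m E E_sym B1 none) => //.
    by apply: sbad_anyP; rewrite [has _ _]orbA orbF negb_or s1 s2.
  move=> u v; rewrite !inE => /orP[]/eqP-> /orP[]/eqP-> // _; rewrite sw1 sw2.
    case: pr => [pr|pr]; [by left | right; split=> //].
    by move: pr; rewrite inE => /andP[/eqP].
  case: pr => [pr|pr]; [by left; rewrite pbadC | right; split=> //].
    by move: pr; rewrite inE => /andP[/eqP].
  by rewrite B1_sym.
- by apply/avoid2P.
Qed.

Let S := good_assignments B1 none.
Let A := [set rho in S | rho u1 == rho u2].

Lemma loop_upper : #|A| * (N ^ 2 - 38 * d ^ 2 * N) <= #|S| * Q.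
Proof.
pose bad rho (w : U * U) :=
  [|| sbad_any rho us w.1, sbad_any rho us w.2 | pbad m E rho w.1 w.2].
apply: (@double_count {ffun U -> V} (U * U)%type _ _
  (fun rho => [set z | ~~ bad rho z]) eq_pairs
  (fun z => swapf us [:: z.1; z.2])).
- move=> rho w; rewrite inE => /andP[rS r12]; rewrite inE => /norP[b1 /norP[b2 b3]].
  have [un fS] := swap2_good rS b1 b2 (or_introl b3).
  split=> //; last exact: swapfK.
  have sv1 := swap_nthV u1 (erefl : size us = size [:: w.1; w.2]) un (erefl : 0 < 2).
  have sv2 := swap_nthV u1 (erefl : size us = size [:: w.1; w.2]) un (erefl : 1 < 2).
  rewrite /= in sv1 sv2; rewrite inE !ffunE sv1 sv2 r12 /=; move: un; rewrite cat_uniq.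
  by case/and3P => _ _; rewrite /= inE andbT.
- move=> rho; rewrite inE => /andP[/good_assignmentsP[rA _ _] _].
  have sb := card_sbad_any us rA.
  have c1 : #|[set z : U * U | sbad_any rho us z.1]| <= 16 * d ^ 2 * N.
    apply: leq_trans (@card_proj_le (U * U)%type U U id (sbad_any rho us) (@inj_id _)) _.
    by rewrite leq_mul2r; apply/orP; right; move: sb => /=; lia.
  have c2 : #|[set z : U * U | sbad_any rho us z.2]| <= 16 * d ^ 2 * N.
    have swinj : injective (fun x : U * U => (x.2, x.1)).
      by move=> [x y] [x' y'] [-> ->].
    apply: leq_trans (card_proj_le (sbad_any rho us) swinj) _.
    by rewrite leq_mul2r; apply/orP; right; move: sb => /=; lia.
  have c3 : #|[set z : U * U | pbad m E rho z.1 z.2]| <= N * (6 * d ^ 2).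
    apply: leq_trans (card_pairs_le (A := xpredT) (P := pbad m E rho)
      (fun u _ => card_pbad u rA)) _.
    by rewrite leq_mul2r max_card orbT.
  have cB : #|[set z | bad rho z]| <= 38 * d ^ 2 * N.
    by apply: leq_trans (card_set_or_le c1 (card_set_or_le c2 c3)) _; lia.
  have := cardsC [set z | bad rho z]; rewrite card_prod -/N mulnn.
  have -> : ~: [set z | bad rho z] = [set z | ~~ bad rho z].
    by apply/setP => z; rewrite !inE.
  by move=> <-; rewrite leq_subLR leq_add2r.
- by move=> rho /good_assignmentsP[rA _ _]; rewrite card_eq_pairs.
Qed.

Lemma loop_lower : #|S| * (Q - 32 * d ^ 3) <= #|A| * N ^ 2.
Proof.
pose bad rho (w : U * U) := (w \in eq_pairs rho) && sbad_any rho us w.1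
  || (w \in eq_pairs rho) && sbad_any rho us w.2.
apply: (@double_count {ffun U -> V} (U * U)%type _ _
  (fun rho => eq_pairs rho :\: [set z | bad rho z]) (fun _ => setT)
  (fun z => swapf us [:: z.1; z.2])).
- move=> rho w rS; rewrite inE andbC => /andP[we].
  rewrite inE /bad we /= => /norP[b1 b2].
  have we' : (w.1, w.2) \in eq_pairs rho by rewrite -surjective_pairing.
  have [un fS] := swap2_good rS b1 b2 (or_intror we').
  split; [|by rewrite inE|exact: swapfK].
  have sw1 := swap_nth u1 (erefl : size us = size [:: w.1; w.2]) un (erefl : 0 < 2).
  have sw2 := swap_nth u1 (erefl : size us = size [:: w.1; w.2]) un (erefl : 1 < 2).
  rewrite /= in sw1 sw2; rewrite inE fS !ffunE sw1 sw2 /=.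
  by move: we; rewrite inE => /andP[].
- move=> rho /good_assignmentsP[rA _ _].
  have sb := card_sbad_any us rA.
  rewrite cardsD card_eq_pairs //; apply: leq_sub2l.
  apply: leq_trans (_ : #|[set z | bad rho z]| <= _).
    by apply: subset_leq_card; apply: subsetIr.
  apply: leq_trans (card_set_or_le (card_eq_pairs1_le rA sb) (card_eq_pairs2_le rA sb)) _.
  by rewrite /=; lia.
- by move=> rho _; rewrite cardsT card_prod mulnn.
Qed.

End Loops.

Section DoubleEdges.
Variables (B1 B2 : rel U) (u1 u3 : U).
Let u2 := m u1.
Let u4 := m u3.
Hypotheses (B1_sym : symmetric B1) (B1E : subrel B1 E)
  (B2_sym : symmetric B2) (B2m : forall p q, B2 p q -> B2 (m p) (m q))
  (B2B1 : forall p q, B2 p q -> B1 p (m p)).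
Hypotheses (B1_13 : ~~ B1 u1 u3) (B1_24 : ~~ B1 u2 u4)
  (B2_13 : ~~ B2 u1 u3) (us_uniq : uniq [:: u1; u3; u2; u4]).

Let us := [:: u1; u3; u2; u4].
Let S := good_assignments B1 B2.
Let A := [set rho in S | (rho u1 == rho u3) && (rho u2 == rho u4)].

Let wss (z : (U * U) * (U * U)) := [:: z.1.1; z.1.2; z.2.1; z.2.2].

Let sbad4 rho z := [|| sbad_any rho us z.1.1, sbad_any rho us z.1.2,
  sbad_any rho us z.2.1 | sbad_any rho us z.2.2].

Let cross rho (z : (U * U) * (U * U)) :=
  [|| pbad m E rho z.1.1 z.2.1, pbad m E rho z.1.1 z.2.2,
      pbad m E rho z.1.2 z.2.1 | pbad m E rho z.1.2 z.2.2].

Lemma swap4_good rho (z : (U * U) * (U * U)) : rho \in S ->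
  ~~ sbad4 rho z -> ~~ cross rho z ->
  ~~ pbad m E rho z.1.1 z.1.2 \/ z.1 \in eq_pairs rho ->
  ~~ pbad m E rho z.2.1 z.2.2 \/ z.2 \in eq_pairs rho ->
  uniq (us ++ wss z) /\ swapf us (wss z) rho \in S.
Proof.
case: z => [[w1 w3] [w2 w4]] /=; rewrite /sbad4 /cross /wss /=.
case/good_assignmentsP => rA av1 av2 /norP[s1 /norP[s3 /norP[s2 s4]]].
case/norP => p12 /norP[p14 /norP[p32 p34]] pr13 pr24.
have ne v w : ~~ pbad m E rho v w -> v != w by case/norP.
have w13 : w1 != w3 by case: pr13 => [/ne //|]; rewrite inE => /andP[].
have w24 : w2 != w4 by case: pr24 => [/ne //|]; rewrite inE => /andP[].
have un : uniq (us ++ [:: w1; w3; w2; w4]).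
  rewrite cat_uniq us_uniq; apply/andP; split=> //; apply/andP; split.
    apply/hasPn => w /[!inE] /or4P[] /eqP->.
    - by have := @sbad_any_notin rho us w1 s1; rewrite !inE.
    - by have := @sbad_any_notin rho us w3 s3; rewrite !inE.
    - by have := @sbad_any_notin rho us w2 s2; rewrite !inE.
    - by have := @sbad_any_notin rho us w4 s4; rewrite !inE.
  by rewrite /= !inE !negb_or w13 w24 (ne _ _ p12) (ne _ _ p14) (ne _ _ p32) (ne _ _ p34).
have sz : size us = size [:: w1; w3; w2; w4] by [].
have sw1 := swap_nth u1 sz un (erefl : 0 < 4).
have sw3 := swap_nth u1 sz un (erefl : 1 < 4).
have sw2 := swap_nth u1 sz un (erefl : 2 < 4).
have sw4 := swap_nth u1 sz un (erefl : 3 < 4).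
rewrite /= in sw1 sw2 sw3 sw4; split=> //.
have singles : forall u w, u \in us -> w \in [:: w1; w3; w2; w4] ->
    ~~ sbad m E rho u w.
  apply: sbad_anyP; apply/norP; split=> //; apply/norP; split=> //.
  by apply/norP; split=> //; apply/norP.
have B2_31 : ~~ B2 u3 u1 by rewrite B2_sym.
have B2_24 : ~~ B2 u2 u4.
  by apply/negP => /B2m; rewrite !mK; apply/negP.
have B2_42 : ~~ B2 u4 u2 by rewrite B2_sym.
have B1_31 : ~~ B1 u3 u1 by rewrite B1_sym.
have B1_42 : ~~ B1 u4 u2 by rewrite B1_sym.
have eqp v w : (v, w) \in eq_pairs rho -> rho v = rho w by rewrite inE => /andP[/eqP].
have pairs : forall u v, u \in us -> v \in us -> u <> v ->
     ~~ pbad m E rho (swap us [:: w1; w3; w2; w4] u) (swap us [:: w1; w3; w2; w4] v) \/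
     [/\ rho (swap us [:: w1; w3; w2; w4] u) = rho (swap us [:: w1; w3; w2; w4] v),
         ~~ B1 u v & ~~ B2 u v].
  move=> u v; rewrite !inE.
  do 2![case/or4P => /eqP->]; rewrite ?sw1 ?sw2 ?sw3 ?sw4 => // _;
    try by [left | left; rewrite pbadC].
  - by case: pr13 => [|/eqp]; [left | right; split].
  - by case: pr13 => [|/eqp]; [left; rewrite pbadC | right; split].
  - by case: pr24 => [|/eqp]; [left | right; split].
  - by case: pr24 => [|/eqp]; [left; rewrite pbadC | right; split].
apply/good_assignmentsP; split.
- exact: swapf_assignments.
- exact: (@swapf_avoid1 _ _ m E E_sym B1 B2).
- apply: (@swapf_avoid2 _ _ m E mK B1 B2) => //.
  move=> p q _; rewrite !inE => /or4P[] /eqP ->; rewrite ?mK eqxx ?orbT //.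
Qed.

Let swap4_val rho z : uniq (us ++ wss z) ->
  [/\ swapf us (wss z) rho u1 = rho z.1.1, swapf us (wss z) rho u3 = rho z.1.2,
      swapf us (wss z) rho u2 = rho z.2.1 & swapf us (wss z) rho u4 = rho z.2.2].
Proof.
move=> un; have sz : size us = size (wss z) by [].
have sw1 := swap_nth u1 sz un (erefl : 0 < 4).
have sw3 := swap_nth u1 sz un (erefl : 1 < 4).
have sw2 := swap_nth u1 sz un (erefl : 2 < 4).
have sw4 := swap_nth u1 sz un (erefl : 3 < 4).
by rewrite /= in sw1 sw2 sw3 sw4; rewrite !ffunE sw1 sw2 sw3 sw4.
Qed.

Let swap4_valV rho z : uniq (us ++ wss z) ->
  [/\ swapf us (wss z) rho z.1.1 = rho u1, swapf us (wss z) rho z.1.2 = rho u3,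
      swapf us (wss z) rho z.2.1 = rho u2 & swapf us (wss z) rho z.2.2 = rho u4].
Proof.
move=> un; have sz : size us = size (wss z) by [].
have sw1 := swap_nthV u1 sz un (erefl : 0 < 4).
have sw3 := swap_nthV u1 sz un (erefl : 1 < 4).
have sw2 := swap_nthV u1 sz un (erefl : 2 < 4).
have sw4 := swap_nthV u1 sz un (erefl : 3 < 4).
by rewrite /= in sw1 sw2 sw3 sw4; rewrite !ffunE sw1 sw2 sw3 sw4.
Qed.

Lemma double_upper :
  #|A| * (N ^ 4 - 164 * d ^ 2 * N ^ 3) <= #|S| * Q ^ 2.
Proof.
pose bad rho (z : (U * U) * (U * U)) :=
  [|| sbad4 rho z, cross rho z, pbad m E rho z.1.1 z.1.2 |
      pbad m E rho z.2.1 z.2.2].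
apply: (@double_count {ffun U -> V} ((U * U) * (U * U))%type _ _
  (fun rho => [set z | ~~ bad rho z]) (fun rho => setX (eq_pairs rho) (eq_pairs rho))
  (fun z => swapf us (wss z))).
- move=> rho z; rewrite inE => /and3P[rS r13 r24].
  rewrite inE => /norP[b1 /norP[b2 /norP[b3 b4]]].
  have [un fS] := swap4_good rS b1 b2 (or_introl b3) (or_introl b4).
  have [v1 v3 v2 v4] := swap4_valV rho un.
  split=> //; last exact: swapfK.
  rewrite !inE v1 v2 v3 v4 r13 r24 /=; move: un; rewrite cat_uniq.
  case/and3P => _ _; rewrite /= !inE !negb_or.
  by case/and4P => /andP[-> _] _ -> _.
- move=> rho; rewrite inE => /andP[/good_assignmentsP[rA _ _] _].
  have sb := card_sbad_any us rA.
  have single (g : (U * U) * (U * U) -> U * (U * (U * U))) : injective g ->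
      #|[set z | sbad_any rho us (g z).1]| <= 32 * d ^ 2 * N ^ 3.
    move=> ginj; apply: leq_trans (card_proj_le (sbad_any rho us) ginj) _.
    rewrite !card_prod -/N (_ : N * (N * N) = N ^ 3); last by rewrite !expnS muln1.
    by rewrite leq_mul2r; apply/orP; right; move: sb => /=; lia.
  have pair (g : (U * U) * (U * U) -> (U * U) * (U * U)) : injective g ->
      #|[set z | pbad m E rho (g z).1.1 (g z).1.2]| <= 6 * d ^ 2 * N ^ 3.
    move=> ginj.
    apply: leq_trans (card_proj_le (fun y => pbad m E rho y.1 y.2) ginj) _.
    rewrite !card_prod -/N.
    rewrite (_ : 6 * d ^ 2 * N ^ 3 = N * (6 * d ^ 2) * (N * N)); last by nia.
    rewrite leq_mul2r; apply/orP; right.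
    apply: leq_trans (card_pairs_le (A := xpredT) (P := pbad m E rho)
      (fun u _ => card_pbad u rA)) _.
    by rewrite leq_mul2r max_card orbT.
  have i11 : injective (fun z : (U * U) * (U * U) => (z.1.1, (z.1.2, z.2))).
    by move=> [[? ?] ?] [[? ?] ?] [-> -> ->].
  have i12 : injective (fun z : (U * U) * (U * U) => (z.1.2, (z.1.1, z.2))).
    by move=> [[? ?] ?] [[? ?] ?] [-> -> ->].
  have i21 : injective (fun z : (U * U) * (U * U) => (z.2.1, (z.2.2, z.1))).
    by move=> [? [? ?]] [? [? ?]] [-> -> ->].
  have i22 : injective (fun z : (U * U) * (U * U) => (z.2.2, (z.2.1, z.1))).
    by move=> [? [? ?]] [? [? ?]] [-> -> ->].
  have j12 : injective (fun z : (U * U) * (U * U) => ((z.1.1, z.2.1), (z.1.2, z.2.2))).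
    by move=> [[? ?] [? ?]] [[? ?] [? ?]] [-> -> -> ->].
  have j14 : injective (fun z : (U * U) * (U * U) => ((z.1.1, z.2.2), (z.1.2, z.2.1))).
    by move=> [[? ?] [? ?]] [[? ?] [? ?]] [-> -> -> ->].
  have j32 : injective (fun z : (U * U) * (U * U) => ((z.1.2, z.2.1), (z.1.1, z.2.2))).
    by move=> [[? ?] [? ?]] [[? ?] [? ?]] [-> -> -> ->].
  have j34 : injective (fun z : (U * U) * (U * U) => ((z.1.2, z.2.2), (z.1.1, z.2.1))).
    by move=> [[? ?] [? ?]] [[? ?] [? ?]] [-> -> -> ->].
  have j13 : injective (fun z : (U * U) * (U * U) => (z.1, z.2)).
    by move=> [? ?] [? ?] [-> ->].
  have j24 : injective (fun z : (U * U) * (U * U) => (z.2, z.1)).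
    by move=> [? ?] [? ?] [-> ->].
  have cB : #|[set z | bad rho z]| <= 164 * d ^ 2 * N ^ 3.
    have c1 := card_set_or_le (single _ i11) (card_set_or_le (single _ i12)
      (card_set_or_le (single _ i21) (single _ i22))).
    have c2 := card_set_or_le (pair _ j12) (card_set_or_le (pair _ j14)
      (card_set_or_le (pair _ j32) (pair _ j34))).
    by apply: leq_trans (card_set_or_le c1 (card_set_or_le c2
      (card_set_or_le (pair _ j13) (pair _ j24)))) _; lia.
  have := cardsC [set z | bad rho z]; rewrite !card_prod -/N.
  rewrite (_ : N * N * (N * N) = N ^ 4); last by rewrite !expnS muln1 !mulnA.
  have -> : ~: [set z | bad rho z] = [set z | ~~ bad rho z].
    by apply/setP => z; rewrite !inE.
  by move=> <-; rewrite leq_subLR leq_add2r.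
- by move=> rho /good_assignmentsP[rA _ _]; rewrite cardsX card_eq_pairs.
Qed.

Lemma double_lower :
  #|S| * (Q ^ 2 - 152 * d ^ 3 * Q) <= #|A| * N ^ 4.
Proof.
pose inE2 rho (z : (U * U) * (U * U)) := (z.1 \in eq_pairs rho) && (z.2 \in eq_pairs rho).
pose bad rho (z : (U * U) * (U * U)) := inE2 rho z && (sbad4 rho z || cross rho z).
apply: (@double_count {ffun U -> V} ((U * U) * (U * U))%type _ _
  (fun rho => setX (eq_pairs rho) (eq_pairs rho) :\: [set z | bad rho z])
  (fun _ => setT) (fun z => swapf us (wss z))).
- move=> rho z rS; rewrite inE andbC {1}[z]surjective_pairing in_setX.
  case/andP => /andP[e1 e2]; rewrite inE /bad /inE2 e1 e2 => /norP[b1 b2].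
  have [un fS] := swap4_good rS b1 b2 (or_intror e1) (or_intror e2).
  have [v1 v3 v2 v4] := swap4_val rho un.
  split; [|by rewrite inE|exact: swapfK].
  rewrite inE fS v1 v2 v3 v4; move: e1 e2; rewrite !inE.
  by case/andP => -> _ /andP[-> _].
- move=> rho /good_assignmentsP[rA _ _].
  have sb := card_sbad_any us rA.
  have cQ := card_eq_pairs rA.
  rewrite cardsD cardsX cQ mulnn; apply: leq_sub2l.
  apply: leq_trans (_ : #|[set z | bad rho z]| <= _).
    by apply: subset_leq_card; apply: subsetIr.
  have eqQ : #|[set x | x \in eq_pairs rho]| = Q.
    by rewrite -cQ; apply: eq_card => x; rewrite inE.
  have sb1 := card_eq_pairs1_le rA sb; have sb2 := card_eq_pairs2_le rA sb.
  have prod (P1 P2 : pred (U * U)) t1 t2 :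
      #|[set x | (x \in eq_pairs rho) && P1 x]| <= t1 ->
      #|[set x | (x \in eq_pairs rho) && P2 x]| <= t2 ->
      #|[set z : (U * U) * (U * U) | ((z.1 \in eq_pairs rho) && P1 z.1)
           && ((z.2 \in eq_pairs rho) && P2 z.2)]| <= t1 * t2.
    move=> h1 h2; apply: leq_trans (card_pairs_le
      (A := fun x => (x \in eq_pairs rho) && P1 x)
      (P := fun _ x => (x \in eq_pairs rho) && P2 x) (fun _ _ => h2)) _.
    by rewrite leq_mul2r h1 orbT.
  have pT : #|[set x | (x \in eq_pairs rho) && true]| <= Q.
    by rewrite -eqQ; apply/eq_leq/eq_card => x; rewrite !inE andbT.
  have cr (f : U * U -> U) (g : U * U -> U) : (forall t (T : pred U),
      #|[set u | T u]| <= t -> #|[set x | (x \in eq_pairs rho) && T (g x)]| <= t * d) ->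
    #|[set z : (U * U) * (U * U) | (z.1 \in eq_pairs rho) &&
        ((z.2 \in eq_pairs rho) && pbad m E rho (f z.1) (g z.2))]| <= Q * (6 * d ^ 2 * d).
    move=> h; rewrite -eqQ; apply: (card_pairs_le (A := mem (eq_pairs rho))
      (P := fun x y => (y \in eq_pairs rho) && pbad m E rho (f x) (g y))) => x _.
    by apply: h => //; apply: card_pbad.
  have g1 := fun t T => @card_eq_pairs1_le rho T t rA.
  have g2 := fun t T => @card_eq_pairs2_le rho T t rA.
  have cB := card_set_or_le (prod _ _ _ _ sb1 pT) (card_set_or_le (prod _ _ _ _ sb2 pT)
    (card_set_or_le (prod _ _ _ _ pT sb1) (card_set_or_le (prod _ _ _ _ pT sb2)
    (card_set_or_le (cr fst fst g1) (card_set_or_le (cr fst snd g2)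
    (card_set_or_le (cr snd fst g1) (cr snd snd g2))))))).
  apply: leq_trans (leq_trans (subset_leq_card _) cB) _.
    apply/subsetP => z; rewrite in_set => /andP[/andP[e1 e2] b].
    by rewrite in_set e1 e2 /= !andbT; move: b; rewrite /sbad4 /cross -!orbA.
  by rewrite /=; lia.
- by move=> rho _; rewrite cardsT !card_prod; nia.
Qed.

End DoubleEdges.
End Ratio.

(** * Counting injections and assignments *)

Section FiberwiseInjections.
Variables (T' I : finType) (g : T' -> I).

Lemma card_fiberwise_uniq (n : nat) (c : n.-tuple I) :
  #|[set s : n.-tuple T' | uniq s && (map g s == c)]|
    = \prod_i #|[set x | g x == i]| ^_ (count_mem i c).
Proof.
elim: n c => [|n IH] c.
  rewrite big1 => [|i _]; last by rewrite (tuple0 c) ffactn0.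
  apply/eqP/cards1P; exists [tuple]; apply/setP => s.
  by rewrite !inE (tuple0 s) (tuple0 c) !eqxx.
case/tupleP: c => c0 c.
pose h (z : n.-tuple T' * T') := [tuple of z.2 :: z.1].
have hinj : injective h.
  by move=> [s x] [s' x'] /(congr1 val) /= [-> /val_inj ->].
pose P (s : n.-tuple T') := uniq s && (map g s == c).
pose X (s : n.-tuple T') x := (x \notin s) && (g x == c0).
have -> : [set s : n.+1.-tuple T' | uniq s && (map g s == [tuple of c0 :: c])]
    = h @: [set z | P z.1 && X z.1 z.2].
  apply/setP => s; apply/idP/imsetP.
    case/tupleP: s => x s; rewrite inE /= eqseq_cons => /andP[/andP[xs us] /andP[gx gs]].
    by exists (s, x) => //; rewrite inE /P /X /= xs us gx gs.
  case=> [[s' x]]; rewrite inE /P /X /= => /andP[/andP[us gs] /andP[xs gx]] ->.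
  by rewrite inE /= eqseq_cons xs us gx.
rewrite (card_imset _ hinj) card_pairs.
have cX s : P s -> #|[set x | X s x]| = #|[set x | g x == c0]| - count_mem c0 c.
  case/andP => us /eqP gs.
  have -> : [set x | X s x] = [set x | g x == c0] :\: [set x in s].
    by apply/setP => x; rewrite !inE.
  rewrite cardsD; congr (_ - _).
  rewrite -gs count_map -size_filter -(card_uniqP (filter_uniq _ us)).
  by apply: eq_card => x; rewrite !inE mem_filter.
rewrite (eq_bigr _ cX) sum_nat_cond_const.
rewrite (_ : #|[set x | P x]| = \prod_i #|[set x | g x == i]| ^_ (count_mem i c)); last exact: IH.
rewrite (bigD1 c0) //= [RHS](bigD1 c0) //= eqxx add1n ffactnSr.
rewrite [LHS]mulnAC; congr (_ * _); apply: eq_bigr => i /negbTE ne.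
by rewrite eq_sym ne add0n.
Qed.

Lemma card_fiberwise_inj (T : finType) (f : T -> I) :
  #|[set h : {ffun T -> T'} | injectiveb h && [forall t, g (h t) == f t]]|
    = \prod_i #|[set x | g x == i]| ^_ #|[set t | f t == i]|.
Proof.
pose c : #|T|.-tuple I := [tuple of map f (enum T)].
transitivity #|[set s : #|T|.-tuple T' | uniq s && (map g s == c)]|; last first.
  rewrite card_fiberwise_uniq; apply: eq_bigr => i _; congr (_ ^_ _).
  rewrite /c /= count_map -size_filter -(card_uniqP (filter_uniq _ (enum_uniq _))).
  by apply: eq_card => t; rewrite !inE mem_filter mem_enum andbT.
pose F (h : {ffun T -> T'}) : #|T|.-tuple T' := [tuple of map h (enum T)].
have Finj : injective F.
  move=> h h' /(congr1 val) /= /eq_in_map e; apply/ffunP => t.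
  by apply: e; rewrite mem_enum.
rewrite -(card_imset _ Finj); apply: eq_card => s; apply/imsetP/idP.
  case=> h; rewrite inE => /andP[hinj /forallP gh] ->; rewrite inE; apply/andP; split.
    by rewrite map_inj_uniq ?enum_uniq //; apply/injectiveP.
  by rewrite /= -map_comp; apply/eqP/eq_in_map => t _; apply/eqP; rewrite /= gh.
rewrite inE => /andP[us /eqP gs].
pose h : {ffun T -> T'} := [ffun t => tnth s (enum_rank t)].
have hi i : h (enum_val i) = tnth s i by rewrite ffunE enum_valK.
have Fh : F h = s.
  apply: eq_from_tnth => i; rewrite -hi tnth_map; congr (h _).
  by rewrite (tnth_nth (enum_val i)) /enum_val; apply: set_nth_default; rewrite -cardE.
exists h; last by rewrite Fh.
rewrite inE; apply/andP; split.
  apply/injectiveP => t t'; rewrite !ffunE => /(tuple_uniqP _ us)/enum_rank_inj //.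
apply/forallP => t; apply/eqP.
have := congr1 (fun c' => nth (f t) c' (enum_rank t)) gs.
rewrite /c /= (nth_map (h t)) ?size_tuple ?ltn_ord // -tnth_nth.
rewrite (nth_map t) -?cardE ?ltn_ord // nth_enum_rank ffunE.
by [].
Qed.
End FiberwiseInjections.

Lemma card_by_fibers (X Y : finType) (A : {set X}) (B : {set Y}) (f : X -> Y) c :
  (forall x, x \in A -> f x \in B) ->
  (forall y, y \in B -> #|[set x in A | f x == y]| = c) ->
  #|A| = #|B| * c.
Proof.
move=> fB fc; rewrite -sum1_card (partition_big f (mem B)) //=.
rewrite -sum_nat_const; apply: eq_bigr => y yB.
by rewrite -(fc y yB) -sum1_card; apply: eq_bigl => x; rewrite inE.
Qed.

Lemma card_tag_fiber (I : finType) (b : I -> nat) (i : I) :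
  #|[set x : {i : I & 'I_(b i)} | tag x == i]| = b i.
Proof.
rewrite -[RHS]card_ord -cardsT.
have inj : injective (fun s : 'I_(b i) => Tagged (fun i => 'I_(b i)) s).
  by move=> s t /eqP; rewrite eq_Tagged => /eqP.
rewrite -(card_imset _ inj); apply: eq_card => x; rewrite inE.
apply/eqP/imsetP => [|[s _ ->] //].
by case: x => j s /= ij; subst j; exists s.
Qed.

Lemma card_tagged_ord (I : finType) (b : I -> nat) :
  #|{: {i : I & 'I_(b i)}}| = \sum_i b i.
Proof.
rewrite -sum1_card (partition_big tag xpredT) //=.
apply: eq_bigr => i _; rewrite -[RHS](card_tag_fiber b i) -sum1_card.
by apply: eq_bigl => x; rewrite !inE.
Qed.

Lemma card_assignments (U V : finType) (a : V -> nat) : \sum_v a v = #|U| ->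
  #|assignments U a| * (\prod_v (a v)`!) = (#|U|)`!.
Proof.
move=> sum_a; pose X := {v : V & 'I_(a v)}.
have cX : #|{: X}| = #|U| by rewrite card_tagged_ord.
rewrite -(ffactnn #|U|) -{1}cX -card_inj_ffuns; symmetry.
apply: (card_by_fibers (f := fun h : {ffun U -> X} => [ffun u => tag (h u)])) => [h|rho].
  rewrite inE => /injectiveP hinj; rewrite inE; apply/forallP => v.
  have hbij : bijective h by apply: inj_card_bij; rewrite ?cX.
  rewrite -[X in _ == X](card_tag_fiber a v).
  rewrite -(on_card_preimset (onW_bij _ hbij)); apply/eqP/eq_card => u.
  by rewrite !inE ffunE.
rewrite inE => /forallP rhoA.
transitivity (#|[set h : {ffun U -> X} | injectiveb h && [forall u, tag (h u) == rho u]]|).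
  apply: eq_card => h; rewrite !inE; congr (_ && _).
  apply/eqP/forallP => [<- u|e]; first by rewrite ffunE.
  by apply/ffunP => u; rewrite ffunE; apply/eqP.
rewrite card_fiberwise_inj; apply: eq_bigr => v _.
by rewrite card_tag_fiber (eqP (rhoA v)) ffactnn.
Qed.

Lemma card_sym_rel (T : finType) (F : rel T) : symmetric F -> irreflexive F ->
  #|[set z : T * T | F z.1 z.2]|
    = 2 * #|[set z : T * T | F z.1 z.2 && (enum_rank z.1 < enum_rank z.2)]|.
Proof.
move=> Fs Fi; pose lt := [set z : T * T | F z.1 z.2 && (enum_rank z.1 < enum_rank z.2)].
pose gt := [set z : T * T | F z.1 z.2 && (enum_rank z.2 < enum_rank z.1)].
have inj : injective (fun z : T * T => (z.2, z.1)) by move=> [? ?] [? ?] [-> ->].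
have -> : [set z : T * T | F z.1 z.2] = lt :|: gt.
  apply/setP => z; rewrite !inE -andb_orr -neq_ltn.
  case: eqP => [/val_inj/enum_rank_inj e|]; rewrite ?andbT //.
  by rewrite e Fi.
rewrite cardsU (_ : lt :&: gt = set0) ?cards0 ?subn0; last first.
  by apply/setP => z; rewrite !inE; lia.
rewrite mulSn mul1n; congr (_ + _); rewrite -[RHS](card_imset _ inj).
apply: eq_card => z; apply/idP/imsetP => [|[[x y]]].
  by rewrite inE => h; exists (z.2, z.1); [rewrite inE /= Fs | case: z {h}].
by rewrite inE /= => h ->; rewrite inE /= Fs.
Qed.

Section Graphs.
Variables (V : finType).
Implicit Types (G : {set {set V}}) (S : {set V}).

Lemma sum_degree G S :
  \sum_(v in S) #|[set e in G | v \in e]| = \sum_(e in G) #|e :&: S|.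
Proof.
rewrite (eq_bigr (fun v => \sum_(e in G) (v \in e))); last first.
  move=> v _; rewrite -sum1dep_card big_mkcondr.
  by apply: eq_bigr => e _; case: (v \in e).
rewrite exchange_big; apply: eq_bigr => e _.
rewrite -sum1_card big_mkcond [RHS]big_mkcond /=.
by apply: eq_bigr => v _; rewrite inE; case: (v \in S); case: (v \in e).
Qed.

Lemma card_link G v : (forall e, e \in G -> #|e| = 2) ->
  #|[set w | [set v; w] \in G]| = #|[set e in G | v \in e]|.
Proof.
move=> G2.
have ne w : [set v; w] \in G -> v != w.
  by move=> /G2; rewrite cards2; case: (v == w).
have inj : {in [set w | [set v; w] \in G] &, injective (fun w => [set v; w])}.
  move=> w w'; rewrite !inE => /ne vw /ne vw' /setP /(_ w).
  by rewrite !inE eqxx orbT (eq_sym w v) (negbTE vw) => /esym/eqP.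
rewrite -(card_in_imset inj); apply: eq_card => e; apply/imsetP/idP => [[w]|].
  by rewrite inE => wG ->; rewrite !inE wG eqxx.
rewrite inE => /andP[eG ve]; have /eqP/cards2P[x [y [xy exy]]] := G2 _ eG.
move: ve eG; rewrite exy !inE => /orP[]/eqP->; [exists y | exists x] => //.
  by rewrite inE.
  by rewrite inE setUC.
by rewrite setUC.
Qed.

Lemma card_oriented_orders G k : (forall e, e \in G -> #|e| = 2) -> #|G| = k ->
  #|[set F : {ffun 'I_k -> V * V} |
      injectiveb (fun j => [set (F j).1; (F j).2])
      && [forall j, [set (F j).1; (F j).2] \in G]]| = k`! * 2 ^ k.
Proof.
move=> G2 Gk; pose und (z : V * V) := [set z.1; z.2].
have -> : k`! = #|[set f : {ffun 'I_k -> {set V}} in ffun_on (mem G) | injectiveb f]|.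
  by rewrite card_inj_ffuns_on card_ord Gk ffactnn.
apply: (card_by_fibers (f := fun F : {ffun 'I_k -> V * V} => [ffun j => und (F j)])) => [F|f].
  rewrite !inE => /andP[/injectiveP Finj /forallP FG]; apply/andP; split.
    by apply/ffun_onP => j; rewrite ffunE; exact: FG.
  by apply/injectiveP => i j; rewrite !ffunE => /Finj.
rewrite !inE => /andP[/ffun_onP fG /injectiveP finj].
transitivity #|family (fun j => [pred z : V * V | und z == f j])|.
  apply: eq_card => F; rewrite !inE; apply/idP/familyP => [/andP[_ /eqP Ff] j|h].
    by rewrite inE -Ff ffunE.
  have Ff j : und (F j) = f j by apply/eqP; have := h j; rewrite inE.
  apply/andP; split; last by apply/eqP/ffunP => j; rewrite ffunE.
  apply/andP; split; last by apply/forallP => j; rewrite -/(und (F j)) Ff fG.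
  by apply/injectiveP => i j; rewrite -!/(und _) !Ff => /finj.
rewrite card_family foldrE big_image /= -[X in _ ^ X]card_ord -prod_nat_const.
apply: eq_bigr => j _.
have /eqP/cards2P[x [y [xy fj]]] := G2 _ (fG j).
have -> : 2 = #|[set (x, y); (y, x)]| by rewrite cards2 xpair_eqE negb_and xy.
apply: eq_card => -[z w]; rewrite !inE fj /und !xpair_eqE /=.
apply/eqP/orP => [/setP h|[] /andP[/eqP-> /eqP->] //]; last by rewrite setUC.
have zxy : (z == x) || (z == y) by have := h z; rewrite !inE eqxx /= => <-.
case/orP: zxy => /eqP zE.
  have := h y; rewrite !inE zE eqxx orbT (eq_sym y x) (negbTE xy) /= => /eqP<-.
  by left; rewrite !eqxx.
have := h x; rewrite !inE zE eqxx (negbTE xy) /= => /eqP<-.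
by right; rewrite !eqxx.
Qed.

End Graphs.

(** * Assignments and B-graphs *)

Section Events.
Variables (U : eqType) (m : U -> U).

Definition unordered_rel (l : seq (U * U)) : rel U :=
  fun p q => ((p, q) \in l) || ((q, p) \in l).

(* The event that equates p with q and m p with m q has four names. *)
Definition mated_rel (l : seq (U * U)) : rel U :=
  fun p q => unordered_rel l p q || unordered_rel l (m p) (m q).

Definition antisym_list (l : seq (U * U)) :=
  forall p q, (p, q) \in l -> (q, p) \notin l.

End Events.

Section Model.
Variables (n : nat) (L R : {set 'I_n}) (d : 'I_n -> nat) (k : nat).

Definition deg_in (S : {set 'I_n}) (i : 'I_n) : nat := if i \in S then d i else 0.

Definition lslot : finType := {i : 'I_n & 'I_(deg_in L i)}.

Definition slot : finType := (lslot + 'I_k * bool)%type.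

Definition mate (u : slot) : slot :=
  match u with inl x => inl x | inr z => inr (z.1, ~~ z.2) end.

Definition same_vertex : rel slot := fun u v =>
  match u, v with
  | inl x, inl y => (tag x == tag y) && (x != y)
  | inr z, inr t => (z.1 == t.1) && (z != t)
  | _, _ => false
  end.

Definition loop_events : seq (slot * slot) :=
  [seq z <- enum {: slot * slot} |
     same_vertex z.1 z.2 && (enum_rank z.1 < enum_rank z.2)].

Definition double_events : seq (slot * slot) :=
  [seq (inr (z.1.1, false), inr (z.1.2, z.2)) |
     z <- enum {: 'I_k * 'I_k * bool} & enum_rank z.1.1 < enum_rank z.1.2].

Lemma mateK : involutive mate.
Proof. by case=> [x|[j b]] //=; rewrite negbK. Qed.

Lemma same_vertex_sym : symmetric same_vertex.
Proof.
by move=> [x|z] [y|t] //=; rewrite [LHS]andbC [RHS]andbC; congr (_ && _); rewrite eq_sym.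
Qed.

Lemma same_vertex_irr : irreflexive same_vertex.
Proof. by move=> [x|z] /=; rewrite !eqxx. Qed.

Lemma same_vertex_card u : #|[set v | same_vertex u v]| =
  match u with inl x => deg_in L (tag x) - 1 | inr _ => 1 end.
Proof.
case: u => [x|[j b]].
  have <- : #|[set y | tag y == tag x] :\ x| = deg_in L (tag x) - 1.
    have := cardsD1 x [set y : lslot | tag y == tag x].
    by rewrite card_tag_fiber inE eqxx => ->; rewrite add1n subn1.
  have inj : injective (inl : lslot -> slot) by move=> ? ? [].
  rewrite -(card_imset _ inj); apply: eq_card => v; rewrite inE.
  apply/idP/imsetP => [|[y]].
    case: v => [y|t] //= /andP[/eqP e ne]; exists y => //.
    by rewrite !inE e eqxx eq_sym ne.
  by rewrite !inE => /andP[ne /eqP e] -> /=; rewrite e eqxx eq_sym ne.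
rewrite -(cards1 (inr (j, ~~ b) : slot)); apply: eq_card => -[y|[i c]]; rewrite !inE //=.
rewrite -[RHS]/((i, c) == (j, ~~ b)) !xpair_eqE (eq_sym i).
by case: (j == i) => //=; case: b; case: c.
Qed.

Lemma mem_loop_events p q : (p, q) \in loop_events =
  same_vertex p q && (enum_rank p < enum_rank q).
Proof. by rewrite mem_filter mem_enum andbT. Qed.

Lemma loop_events_uniq : uniq loop_events.
Proof. by rewrite filter_uniq // enum_uniq. Qed.

Lemma loop_events_anti : antisym_list loop_events.
Proof.
move=> p q; rewrite !mem_loop_events => /andP[_ h].
by rewrite negb_and; apply/orP; right; lia.
Qed.

Lemma size_loop_events :
  (size loop_events).*2 = (\sum_i deg_in L i * (deg_in L i - 1)) + k.*2.
Proof.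
have -> : size loop_events = #|[set z : slot * slot |
    same_vertex z.1 z.2 && (enum_rank z.1 < enum_rank z.2)]|.
  rewrite -(card_uniqP loop_events_uniq); apply: eq_card => -[p q].
  by rewrite mem_loop_events inE.
rewrite -mul2n -(card_sym_rel same_vertex_sym same_vertex_irr).
have := card_pairs xpredT same_vertex; rewrite /= => ->.
rewrite (eq_bigr _ (fun u _ => same_vertex_card u)) big_sumType /=; congr (_ + _).
  rewrite (partition_big tag xpredT) //=; apply: eq_bigr => i _.
  rewrite (eq_bigr (fun=> deg_in L i - 1)); last by move=> x /eqP->.
  rewrite sum_nat_const; congr (_ * _); rewrite -[RHS](card_tag_fiber (deg_in L) i).
  by apply: eq_card => x; rewrite !inE.
by rewrite sum_nat_const card_prod card_ord card_bool muln1 muln2.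
Qed.

Lemma mem_double_events u v : (u, v) \in double_events ->
  exists i j b, [/\ u = inr (i, false), v = inr (j, b) & enum_rank i < enum_rank j].
Proof.
case/mapP => -[[i j] b]; rewrite mem_filter /= => /andP[ij _] [-> ->].
by exists i, j, b.
Qed.

Lemma double_eventsP i j b : i != j ->
  mated_rel mate double_events (inr (i, false)) (inr (j, b)).
Proof.
have mem i' j' b' : enum_rank i' < enum_rank j' ->
    (inr (i', false), inr (j', b')) \in double_events.
  by move=> h; apply/mapP; exists (i', j', b'); rewrite // mem_filter h mem_enum.
move=> ij; rewrite /mated_rel /unordered_rel /=.
have /orP[h|h] : (enum_rank i < enum_rank j) || (enum_rank j < enum_rank i).
  by rewrite -neq_ltn (inj_eq val_inj) (inj_eq enum_rank_inj).
  by rewrite mem.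
by case: b => /=; [rewrite (mem j i true h) !orbT | rewrite (mem j i false h) !orbT].
Qed.

Lemma double_events_uniq : uniq double_events.
Proof.
rewrite map_inj_uniq; first by rewrite filter_uniq // enum_uniq.
by move=> [[i j] b] [[i' j'] b'] [-> -> ->].
Qed.

Lemma double_events_anti : antisym_list double_events.
Proof.
move=> p q /mem_double_events[i [j [b [-> -> ij]]]].
by apply/negP => /mem_double_events[i' [j' [b' [[e1 _] [e2 _] ij']]]]; subst; lia.
Qed.

Lemma double_events_distinct p q : (p, q) \in double_events ->
  [/\ uniq [:: p; q; mate p; mate q], (mate p, mate q) \notin double_events
    & (mate q, mate p) \notin double_events].
Proof.
move=> /mem_double_events[i [j [b [-> -> ij]]]] /=.
have ne : i != j by apply/eqP => e; rewrite e ltnn in ij.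
split.
- rewrite !inE -![inr _ == _]/(_ == _ :> 'I_k * bool) !xpair_eqE !eqxx.
  by rewrite (eq_sym j i) (negbTE ne) /=; case: b.
- by apply/negP => /mem_double_events[i' [j' [b' [e _ _]]]]; case: e.
- by apply/negP => /mem_double_events[i' [j' [b' [[e1 _] [e2 _] ij']]]]; subst; lia.
Qed.

Lemma double_events_same_vertex p q : (p, q) \in double_events ->
  [/\ same_vertex p (mate p), same_vertex q (mate q), ~~ same_vertex p q
    & ~~ same_vertex (mate p) (mate q)].
Proof.
move=> /mem_double_events[i [j [b [-> -> ij]]]] /=.
have ne : i != j by apply/eqP => e; rewrite e ltnn in ij.
rewrite !xpair_eqE !eqxx (negbTE ne) /=.
by case: b.
Qed.

Lemma size_double_events : size double_events = k * (k - 1).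
Proof.
rewrite size_map.
have -> : size [seq z <- enum {: 'I_k * 'I_k * bool} | enum_rank z.1.1 < enum_rank z.1.2]
    = #|[set z : 'I_k * 'I_k * bool | (enum_rank z.1.1 < enum_rank z.1.2) && true]|.
  rewrite -(card_uniqP (filter_uniq _ (enum_uniq _))); apply: eq_card => z.
  by rewrite mem_filter mem_enum inE.
pose lt (z : 'I_k * 'I_k) := enum_rank z.1 < enum_rank z.2.
rewrite (card_pairs lt (fun _ _ => true)).
have ne_sym : symmetric (fun i j : 'I_k => i != j) by move=> i j; rewrite eq_sym.
have ne_irr : irreflexive (fun i j : 'I_k => i != j) by move=> i; rewrite eqxx.
have -> : k * (k - 1) = #|[set z : 'I_k * 'I_k | z.1 != z.2]|.
  have := card_pairs xpredT (fun i j : 'I_k => i != j); rewrite /= => ->.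
  rewrite -{1}(card_ord k) -sum_nat_const; apply: eq_bigr => i _.
  have := cardsC1 i; rewrite card_ord -subn1 => <-.
  by apply: eq_card => j; rewrite !inE eq_sym.
rewrite (card_sym_rel ne_sym ne_irr) (eq_bigr (fun=> 2)); last first.
  by move=> z _; rewrite -card_bool; apply: eq_card => b; rewrite !inE.
rewrite sum_nat_cond_const mulnC; congr (2 * _); apply: eq_card => z; rewrite !inE /lt.
by apply/idP/idP => [h|/andP[] //]; rewrite h andbT; apply/eqP => e; rewrite e ltnn in h.
Qed.

End Model.

Section Bridge.
Variables (n : nat) (L R : {set 'I_n}) (d : 'I_n -> nat) (k : nat).
Hypotheses (LR : bipartition L R) (MLR : M1 d R = M1 d L + k.*2).

Let P := slot L d k.
Implicit Types (rho : {ffun P -> 'I_n}) (G : {set {set 'I_n}}) (v : 'I_n).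

Definition link rho (u : P) : {set 'I_n} :=
  match u with
  | inl x => [set tag x; rho (inl x)]
  | inr z => [set rho (inr z); rho (mate (inr z : P))]
  end.

Definition graph_of rho : {set {set 'I_n}} := link rho @: [set: P].

Definition simple_assignment rho :=
  [/\ forall u, rho u \in R, forall u w, same_vertex u w -> rho u <> rho w &
    forall i j b, i != j -> rho (inr (i, false)) = rho (inr (j, b)) ->
      rho (inr (i, true)) <> rho (inr (j, ~~ b))].

Let good := good_assignments (@mate n L d k) (deg_in d R) (@same_vertex n L d k)
  (mated_rel (@mate n L d k) (double_events L d k)).

Lemma disjLR v : v \in L -> v \in R -> False.
Proof.
case/andP: LR => /pred0P h _ vL vR; by have := h v; rewrite /= vL vR.
Qed.

Lemma coverLR v : v \notin L -> v \in R.
Proof.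
case/andP: LR => _ /eqP h vL; have : v \in L :|: R by rewrite h inE.
by rewrite inE (negbTE vL).
Qed.

Lemma tag_in_L (x : lslot L d) : tag x \in L.
Proof.
case: x => i s /=; case: (boolP (i \in L)) s => // iL.
by rewrite /deg_in (negbTE iL) => -[].
Qed.

Lemma good_simple rho : rho \in good -> simple_assignment rho.
Proof.
case/good_assignmentsP => rA /avoid1P a1 /avoid2P a2; split=> //.
  move=> u; move: rA; rewrite inE => /forallP /(_ (rho u)) /eqP.
  rewrite /deg_in; case: ifP => // _ /eqP; rewrite cards_eq0 => /eqP/setP/(_ u).
  by rewrite !inE eqxx.
by move=> i j b ij; apply: a2; apply: double_eventsP.
Qed.

Lemma simple_good rho : simple_assignment rho ->
  (forall v, #|[set u | rho u == v]| = deg_in d R v) -> rho \in good.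
Proof.
case=> s1 s2 s3 fib; apply/good_assignmentsP; split.
- by rewrite inE; apply/forallP => v; rewrite fib.
- exact/avoid1P.
apply/avoid2P => p q; rewrite /mated_rel /unordered_rel.
have ne i j : enum_rank i < enum_rank j -> i != j :> 'I_k.
  by move=> ij; apply/eqP => e; rewrite e ltnn in ij.
case/orP => /orP[] /mem_double_events[i [j [b [e1 e2 /ne ij]]]].
- by rewrite e1 e2 /=; exact: s3.
- by rewrite e1 e2 /= => /esym h /esym; apply: s3 h.
- rewrite (canRL (@mateK _ _ _ _) e1) (canRL (@mateK _ _ _ _) e2) /= negbK => h1 h2.
  exact: s3 h2 h1.
- rewrite (canRL (@mateK _ _ _ _) e1) (canRL (@mateK _ _ _ _) e2) /= negbK => h1 h2.
  exact: s3 (esym h2) (esym h1).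
Qed.

Section Simple.
Variable rho : {ffun P -> 'I_n}.
Hypothesis rho_simple : simple_assignment rho.

Lemma link_mate u : link rho (mate u) = link rho u.
Proof. by case: u => [x|z] //=; rewrite setUC negbK -surjective_pairing. Qed.

Lemma mem_link u : rho u \in link rho u.
Proof. by case: u => [x|z] /=; rewrite !inE eqxx ?orbT. Qed.

Lemma link_card u : #|link rho u| = 2.
Proof.
have [s1 s2 _] := rho_simple; rewrite /link; case: u => [x|z]; rewrite cards2.
  by case: eqP => // e; case: (disjLR (tag_in_L x)); rewrite e.
case: eqP => // e; case: (s2 (inr z) (mate (inr z))) => //.
by case: z {e} => i b /=; rewrite xpair_eqE !eqxx; case: b.
Qed.

Lemma link_inj u u' : link rho u = link rho u' -> rho u = rho u' -> u = u'.
Proof.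
have [s1 s2 s3] := rho_simple.
have no x z : link rho (inl x) <> link rho (inr z).
  move=> /setP /(_ (tag x)); rewrite !inE eqxx /= => /esym /orP[] /eqP e;
  by apply: (disjLR (tag_in_L x)); rewrite e.
case: u u' => [x|[i b]] [y|[j c]].
- move=> /setP /(_ (tag x)) /=; rewrite !inE eqxx /= => /esym /orP[] /eqP e er.
    congr inl; apply/eqP; case: eqP => // /eqP ne.
    by case: (s2 (inl x) (inl y)) => //=; rewrite e eqxx.
  by case: (disjLR (tag_in_L x)); rewrite e.
- by move=> /no.
- by move=> /esym /no.
move=> el er.
have ne : rho (mate (inr (i, b) : P)) <> rho (inr (i, b)).
  by apply: s2; rewrite /= xpair_eqE !eqxx; case: (b).
have em : rho (mate (inr (i, b) : P)) = rho (mate (inr (j, c) : P)).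
  move/setP: el => /(_ (rho (mate (inr (i, b) : P)))); rewrite !inE eqxx orbT.
  by move=> /esym /orP[] /eqP // e; case: ne; rewrite e er.
have [ij|ij] := eqVneq i j.
  move: ne er em; rewrite /= -ij.
  case: (eqVneq b c) => [->//|bc] ne er em; case: ne.
  by rewrite er; move: bc; case: (b); case: (c).
have ji : j != i by rewrite eq_sym.
move: er em; case: (b) => /= er em; last by case: (s3 i j c ij er em).
have := s3 i j (~~ c) ij em; rewrite negbK; by case.
Qed.

Lemma degree_R v : v \in R -> degree (graph_of rho) v = #|[set u | rho u == v]|.
Proof.
move=> vR; rewrite /degree.
have inj : {in [set u | rho u == v] &, injective (link rho)}.
  move=> u u'; rewrite !inE => /eqP e /eqP e' el.
  by apply: link_inj el _; rewrite e e'.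
rewrite -(card_in_imset inj); apply: eq_card => e; rewrite inE.
apply/andP/imsetP => [[/imsetP[u _ ->] ve]|[u]].
  have [rv|rv] := eqVneq (rho u) v; first by exists u; rewrite ?inE ?rv.
  case: u ve rv => [x|z] /=.
    rewrite !inE => /orP[] /eqP ev; last by rewrite ev eqxx.
    by move=> _; case: (disjLR (tag_in_L x)); rewrite -ev.
  rewrite !inE => /orP[] /eqP ->; first by rewrite eqxx.
  move=> _; exists (mate (inr z : P)); first by rewrite inE.
  by rewrite link_mate.
rewrite inE => /eqP rv ->; split; first by apply: imset_f.
by rewrite -rv mem_link.
Qed.

Lemma degree_L v : v \in L -> degree (graph_of rho) v = deg_in d L v.
Proof.
move=> vL; rewrite /degree.
have [s1 _ _] := rho_simple.
have inj : {in [set x : lslot L d | tag x == v] &, injective (fun x => link rho (inl x))}.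
  move=> x y; rewrite !inE => /eqP ex /eqP ey el.
  suff /(link_inj el) [] : rho (inl x) = rho (inl y) by [].
  move/setP: el => /(_ (rho (inl x))); rewrite !inE eqxx orbT.
  move=> /esym /orP[] /eqP // e; case: (disjLR (tag_in_L y)); rewrite -e; exact: s1.
rewrite -(card_tag_fiber (deg_in d L) v) -(card_in_imset inj).
apply: eq_card => e; rewrite inE.
apply/andP/imsetP => [[/imsetP[u _ ->] ve]|[x]].
  have nv w : v != rho w by apply/eqP => h; apply: (disjLR vL); rewrite h.
  case: u ve => [x|z]; rewrite !inE ?(negbTE (nv _)) // orbF => /eqP ->.
  by exists x; rewrite ?inE.
rewrite inE => /eqP tv ->; split; first by apply: imset_f.
by rewrite !inE tv eqxx.
Qed.

Lemma graph_of_Bgraph : Bgraph L R (graph_of rho).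
Proof.
have [s1 _ _] := rho_simple.
apply/and3P; split=> //; apply/forallP => e; apply/implyP => /imsetP[u _ ->].
  by rewrite link_card.
by apply/negP => /subsetP /(_ _ (mem_link u)) h; apply: disjLR h (s1 u).
Qed.

End Simple.

Lemma sum_deg_in (S : {set 'I_n}) : \sum_i deg_in d S i = M1 d S.
Proof. by rewrite /M1 [RHS]big_mkcond. Qed.

Lemma M_split : M d = M1 d L + M1 d R.
Proof.
rewrite /M (bigID (mem L)) /=; congr (_ + _); apply: eq_bigl => v.
by apply/idP/idP => [/coverLR//|vR]; apply/negP => vL; exact: disjLR vL vR.
Qed.

Lemma card_slot : #|{: P}| = M1 d R.
Proof.
rewrite card_sum card_prod card_ord card_bool muln2.
by rewrite (card_tagged_ord (deg_in d L)) sum_deg_in.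
Qed.

Section Fiber.
Variable G : {set {set 'I_n}}.
Hypotheses (G_B : Bgraph L R G) (G_d : forall v, degree G v = d v).

Lemma G_card2 e : e \in G -> #|e| = 2.
Proof. by case/and3P: G_B => _ /forallP /(_ e) /implyP h _ /h /eqP. Qed.

Lemma G_indep e : e \in G -> ~~ (e \subset L).
Proof. by case/and3P: G_B => _ _ /forallP /(_ e) /implyP. Qed.

Let GR := [set e in G | e \subset R].

Lemma card_G : #|G|.*2 = M1 d L + M1 d R.
Proof.
rewrite -muln2 -sum_nat_const (eq_bigr (fun e => #|e :&: [set: 'I_n]|)); last first.
  by move=> e eG; rewrite setIT G_card2.
rewrite -sum_degree -M_split /M.
by apply: eq_big => [v|v _]; rewrite ?inE // -G_d.
Qed.

Lemma card_GR : #|GR| = k.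
Proof.
have hL : M1 d L = #|G :\: GR|.
  rewrite /M1 (eq_bigr (fun v => #|[set e in G | v \in e]|)); last by move=> v _; rewrite -G_d.
  rewrite sum_degree -sum1_card big_mkcond [RHS]big_mkcond /=; apply: eq_bigr => e _.
  rewrite !inE; case eG: (e \in G) => //=; rewrite andbT.
  have := cardsID L e; rewrite (G_card2 eG) => c2.
  have : 0 < #|e :\: L| by rewrite card_gt0 setD_eq0 G_indep.
  case: (boolP (e \subset R)) => [/subsetP eR _|/subsetPn[z ze zR] h] /=.
    apply/eqP; rewrite cards_eq0; apply/eqP/setP => z; rewrite !inE.
    by apply/negP => /andP[/eR zR zL]; apply: disjLR zL zR.
  have : 0 < #|e :&: L|.
    apply/card_gt0P; exists z; rewrite inE ze /=.
    by apply/negPn/negP => /coverLR zR'; rewrite zR' in zR.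
  by move: c2 h; move: #|e :&: L| #|e :\: L| => x y; lia.
have := cardsID GR G; rewrite -hL (setIidPr _); last first.
  by apply/subsetP => e; rewrite inE => /andP[].
by have := card_G; lia.
Qed.

Let und (z : 'I_n * 'I_n) := [set z.1; z.2].

Definition left_choices := [set h : {ffun lslot L d -> 'I_n} |
  injectiveb (fun x => (tag x, h x)) && [forall x, [set tag x; h x] \in G]].

Definition right_choices := [set F : {ffun 'I_k -> 'I_n * 'I_n} |
  injectiveb (fun j => [set (F j).1; (F j).2])
  && [forall j, [set (F j).1; (F j).2] \in GR]].

Definition glue (z : {ffun lslot L d -> 'I_n} * {ffun 'I_k -> 'I_n * 'I_n}) :
    {ffun P -> 'I_n} :=
  [ffun u : P => match u with
    | inl x => z.1 x
    | inr y => if y.2 then (z.2 y.1).2 else (z.2 y.1).1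
    end].

Lemma glue_inj : injective glue.
Proof.
move=> [h F] [h' F'] /ffunP e; congr (_, _); apply/ffunP => x.
  by have := e (inl x); rewrite !ffunE.
have := e (inr (x, true)); have := e (inr (x, false)); rewrite !ffunE /=.
by case: (F x) (F' x) => [? ?] [? ?] /= -> ->.
Qed.

Lemma card_left_choices : #|left_choices| = \prod_i (deg_in d L i)`!.
Proof.
pose g (z : 'I_n * 'I_n) := if (z.1 \in L) && ([set z.1; z.2] \in G) then Some z.1 else None.
pose pr (h : {ffun lslot L d -> 'I_n}) := [ffun x => (tag x, h x)].
have pr_inj : injective pr.
  by move=> h h' /ffunP e; apply/ffunP => x; have := e x; rewrite !ffunE => -[].
have gE z v : (g z == Some v) = [&& v \in L, z.1 == v & [set v; z.2] \in G].
  rewrite /g; apply/eqP/and3P => [|[vL /eqP -> ->]]; last by rewrite vL.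
  by case: ifP => // /andP[zL zG] [<-].
transitivity #|[set h : {ffun lslot L d -> 'I_n * 'I_n} |
    injectiveb h && [forall x, g (h x) == Some (tag x)]]|.
  rewrite -(card_imset _ pr_inj); apply: eq_card => h; apply/imsetP/idP.
    case=> h'; rewrite inE => /andP[/injectiveP hi /forallP hG] ->.
    rewrite inE; apply/andP; split.
      by apply/injectiveP => x y; rewrite !ffunE => /hi.
    by apply/forallP => x; rewrite gE ffunE /= eqxx tag_in_L hG.
  rewrite inE => /andP[/injectiveP hi /forallP hg].
  have hE x : h x = (tag x, (h x).2).
    by have := hg x; rewrite gE => /and3P[_ /eqP <- _]; case: (h x).
  exists [ffun x => (h x).2]; last by apply/ffunP => x; rewrite !ffunE -hE.
  rewrite inE; apply/andP; split.
    by apply/injectiveP => x y; rewrite !ffunE -!hE => /hi.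
  by apply/forallP => x; rewrite ffunE; have := hg x; rewrite gE => /and3P[].
rewrite card_fiberwise_inj (bigD1 None) //=.
rewrite (_ : [set t | Some (tag t) == None] = set0); last by apply/setP => t; rewrite !inE.
rewrite cards0 ffactn0 mul1n (reindex_omap Some id) => [|[]] //.
rewrite (eq_bigl xpredT) => [|v]; last by rewrite eqxx.
apply: eq_bigr => v _.
have -> : #|[set t : lslot L d | Some (tag t) == Some v]| = deg_in d L v.
  by rewrite -[RHS](card_tag_fiber (deg_in d L)); apply: eq_card => t; rewrite !inE.
have [vL|vL] := boolP (v \in L); last by rewrite /deg_in (negbTE vL) ffactn0.
suff -> : #|[set z | g z == Some v]| = deg_in d L v by rewrite ffactnn.
rewrite /deg_in vL -G_d /degree -(card_link v G_card2).
have inj : injective (fun w : 'I_n => (v, w)) by move=> ? ? [].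
rewrite -(card_imset [set w | _] inj); apply: eq_card => z; rewrite inE gE vL /=.
apply/andP/imsetP => [[/eqP <- zG]|[w]]; first by exists z.2; rewrite ?inE //; case: (z).
by rewrite inE => wG ->.
Qed.

Lemma glue_simple h F : h \in left_choices -> F \in right_choices ->
  simple_assignment (glue (h, F)).
Proof.
rewrite !inE => /andP[/injectiveP hi /forallP hG] /andP[/injectiveP Fi /forallP FG].
have FG' j := FG j.
split.
- case=> [x|[j b]]; rewrite ffunE /=.
    apply: coverLR; apply/negP => hL; have := G_indep (hG x).
    by rewrite subUset !sub1set tag_in_L hL.
  have := FG j; rewrite inE subUset !sub1set => /andP[_ /andP[]].
  by case: b.
- move=> [x|[i b]] [y|[j c]] //=; rewrite !ffunE /=.
    by move=> /andP[/eqP e ne] e'; case/eqP: ne; apply: hi; rewrite e e'.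
  case/andP => /eqP ij; rewrite ij xpair_eqE eqxx /= => bc.
  have := FG j; rewrite inE => /andP[/G_card2 + _]; rewrite cards2.
  by move: bc; case: (b); case: (c) => //= _; case: eqP => // ne _ e; case: ne.
- move=> i j b ij; rewrite !ffunE /= => e1 e2; case/eqP: ij; apply: Fi.
  by rewrite e1 e2; case: b {e1 e2} => /=; rewrite // setUC.
Qed.

Lemma sum_fibers rho : \sum_v #|[set u | rho u == v]| = #|{: P}|.
Proof.
rewrite -[RHS]sum1_card (partition_big rho xpredT) //=.
by apply: eq_bigr => v _; rewrite -sum1dep_card.
Qed.

Lemma card_graph_of rho : simple_assignment rho ->
  #|graph_of rho|.*2 = M1 d L + M1 d R.
Proof.
move=> rs; have [s1 _ _] := rs.
rewrite -muln2 -sum_nat_const (eq_bigr (fun e => #|e :&: [set: 'I_n]|)); last first.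
  by move=> e /imsetP[u _ ->]; rewrite setIT link_card.
rewrite -sum_degree (bigID (mem L)) /=; congr (_ + _).
  rewrite /M1; apply: eq_big => v; rewrite ?inE //= => vL.
  by rewrite -/(degree _ _) degree_L // /deg_in vL.
rewrite -card_slot -(sum_fibers rho) [RHS](bigID (mem L)) /=.
rewrite [X in _ = X + _]big1 ?add0n => [|v vL].
  apply: eq_big => v; rewrite ?inE //= => /coverLR vR.
  by rewrite -/(degree _ _) degree_R.
apply/eqP; rewrite cards_eq0; apply/eqP/setP => u; rewrite !inE.
by apply/eqP => e; apply: (disjLR vL); rewrite -e; apply: s1.
Qed.

Lemma card_graph_fiber :
  #|[set rho in good | graph_of rho == G]| = (\prod_i (deg_in d L i)`!) * (k`! * 2 ^ k).
Proof.
have GR2 e : e \in GR -> #|e| = 2 by rewrite inE => /andP[/G_card2].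
rewrite -card_left_choices -(card_oriented_orders GR2 card_GR) -cardsX.
rewrite -(card_imset _ glue_inj); apply: eq_card => rho; apply/idP/imsetP.
  rewrite inE => /andP[/good_simple rs /eqP gG]; have [s1 s2 s3] := rs.
  pose h : {ffun lslot L d -> 'I_n} := [ffun x => rho (inl x)].
  pose F : {ffun 'I_k -> 'I_n * 'I_n} := [ffun j => (rho (inr (j, false)), rho (inr (j, true)))].
  have lG u : link rho u \in G by rewrite -gG imset_f.
  exists (h, F); last first.
    by apply/ffunP => -[x|[j []]]; rewrite !ffunE.
  rewrite in_setX !inE; apply/andP; split; apply/andP; split.
  - apply/injectiveP => x y; rewrite !ffunE => -[e1 e2]; apply/eqP/negPn/negP => ne.
    by case: (s2 (inl x) (inl y)); rewrite //= e1 eqxx.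
  - by apply/forallP => x; rewrite ffunE; exact: (lG (inl x)).
  - apply/injectiveP => i j; rewrite !ffunE /= => e.
    have el : link rho (inr (i, false)) = link rho (inr (j, false)) by [].
    have : rho (inr (i, false)) \in link rho (inr (j, false)) by rewrite -el mem_link.
    rewrite !inE => /orP[] /eqP er; first by have [] := link_inj rs el er.
    have elm : link rho (inr (i, false)) = link rho (mate (inr (j, false) : P)).
      by rewrite link_mate.
    by have [] := link_inj rs elm er.
  - apply/forallP => j; rewrite !ffunE inE subUset !sub1set /= !s1 !andbT.
    exact: (lG (inr (j, false))).
case=> [[h F]]; rewrite in_setX => /andP[hH FF] ->.
have rs := glue_simple hH FF; have [s1 _ _] := rs.
have gG : graph_of (glue (h, F)) = G.
  apply/eqP; rewrite eqEcard; apply/andP; split; last first.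
    by have := card_graph_of rs; have := card_G; lia.
  apply/subsetP => e /imsetP[u _ ->]; move: hH FF; rewrite !inE.
  move=> /andP[_ /forallP hG] /andP[_ /forallP FG].
  have FG' j : [set (F j).1; (F j).2] \in G by have := FG j; rewrite inE => /andP[].
  case: u => [x|[j b]] /=; rewrite !ffunE /=; first exact: hG.
  by case: b => /=; [rewrite setUC|]; exact: FG'.
rewrite inE gG eqxx andbT; apply: simple_good => // v.
have [vL|/coverLR vR] := boolP (v \in L).
  rewrite /deg_in; case: ifP => [vR|_]; first by case: (disjLR vL vR).
  apply/eqP; rewrite cards_eq0; apply/eqP/setP => u; rewrite !inE.
  by apply/eqP => e; apply: (disjLR vL); rewrite -e; apply: s1.
by rewrite -degree_R // gG G_d /deg_in vR.
Qed.

End Fiber.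

Lemma card_good : #|good| = num_Bgraphs L R d * ((\prod_i (deg_in d L i)`!) * (k`! * 2 ^ k)).
Proof.
apply: (card_by_fibers (f := graph_of)) => [rho rG|G].
  have rs := good_simple rG; rewrite inE graph_of_Bgraph //=.
  apply/forallP => v; have [vL|/coverLR vR] := boolP (v \in L).
    by rewrite degree_L // /deg_in vL.
  rewrite degree_R //; case/good_assignmentsP: rG; rewrite inE => /forallP /(_ v) /eqP -> _ _.
  by rewrite /deg_in vR.
rewrite inE => /andP[GB /forallP Gd]; apply: card_graph_fiber => // v; exact/eqP.
Qed.

End Bridge.

Local Open Scope ring_scope.

(** * Probability that no event occurs *)

Section Steps.
Variable K : realType.
Implicit Types (s a p e x y t D N Q : K).

Lemma expRN_le1B x : 0 <= x -> x <= 1 / 2 -> expR (- (x + 2 * x ^+ 2)) <= 1 - x.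
Proof.
move=> x0 x1; have y0 : 0 < 1 - x by lra.
rewrite expRN -[leRHS]invrK lef_pV2 ?posrE ?expR_gt0 ?invr_gt0 //.
apply: le_trans (_ : 1 + x / (1 - x) <= _).
  by rewrite le_eqVlt; apply/orP; left; apply/eqP; field; lra.
apply: le_trans (expR_ge1Dx _) _; rewrite ler_expR ler_pdivrMr //; nra.
Qed.

Lemma avoid_step s a p e : 0 <= s -> 0 <= p -> 0 <= e -> p + e <= 1 / 2 ->
  s * (p - e) <= a -> a <= s * (p + e) ->
  s * expR (- (p + e + 2 * (p + e) ^+ 2)) <= s - a <= s * expR (- (p - e)).
Proof.
move=> s0 p0 e0 pe lo up; apply/andP; split.
  apply: le_trans (_ : s * (1 - (p + e)) <= _); last by lra.
  by apply: ler_wpM2l => //; apply: expRN_le1B => //; lra.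
apply: le_trans (_ : s * (1 + - (p - e)) <= _); first by lra.
by apply: ler_wpM2l => //; apply: expR_ge1Dx.
Qed.

Lemma avoid_step_error s a p x e c : 0 <= s -> 0 <= p -> p <= x -> x <= 1 / 1000 ->
  0 <= e -> 1000 * e <= x -> x ^+ 2 <= e -> 0 <= c -> c <= 1000 ->
  s * (p - c * e) <= a -> a <= s * (p + c * e) ->
  s * expR (- (p + (c + 8) * e)) <= s - a <= s * expR (- (p - (c + 8) * e)).
Proof.
move=> s0 p0 px x1 e0 ex xe c0 c1 lo up.
have ce0 : 0 <= c * e by exact: mulr_ge0.
have ce : c * e <= 1000 * e by exact: ler_wpM2r.
have pe : p + c * e <= 1 / 2 by lra.
have /andP[h1 h2] := avoid_step s0 p0 ce0 pe lo up.
have sq : (p + c * e) ^+ 2 <= (2 * x) ^+ 2 by rewrite lerXn2r ?nnegrE //; lra.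
rewrite exprMn in sq; rewrite mulrDl; apply/andP; split.
  by apply: le_trans h1; apply: ler_wpM2l => //; rewrite ler_expR; lra.
by apply: (le_trans h2); apply: ler_wpM2l => //; rewrite ler_expR; lra.
Qed.

Lemma upper_step a s T P t : 0 <= a -> 0 <= s -> 0 < T -> 0 <= P -> 0 <= t -> t <= 1 / 2 ->
  a * (T - t * T) <= s * P -> a <= s * (P / T + 2 * t * (P / T)).
Proof.
move=> a0 s0 T0 P0 t0 t1 h.
have Tn : T != 0 by rewrite gt_eqF.
have h1 : a * (1 - t) <= s * (P / T).
  rewrite mulrA ler_pdivlMr // (_ : a * (1 - t) * T = a * (T - t * T)) //; ring.
have h2 : 0 <= s * (P / T) by rewrite mulr_ge0 // divr_ge0 // ltW.
rewrite (_ : s * _ = s * (P / T) + 2 * t * (s * (P / T))); last by ring.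
move: (s * (P / T)) h1 h2 => y h1 h2.
have t2 : 0 < 1 - t by lra.
have h3 : 0 <= t * y * (1 - 2 * t) by rewrite !mulr_ge0 //; lra.
by rewrite -(ler_pM2r t2); lra.
Qed.

Lemma scale_bounds D N Q : 1 <= D -> 1000 * D ^+ 2 <= N -> 0 <= Q -> Q <= D * N ->
  [/\ 0 < N, 0 < D, 0 <= Q / N ^+ 2, Q / N ^+ 2 <= D / N &
      [/\ D ^+ 2 / N <= 1 / 1000 , 0 < D / N, D / N <= 1 / 1000, 0 < D ^+ 2 / N & D <= D ^+ 2]].
Proof.
move=> D1 DN Q0 QN; have D0 : 0 < D by lra.
have D2 : D <= D ^+ 2 by rewrite expr2 ler_peMr // ltW.
have N0 : 0 < N by lra.
have Nn : N != 0 by rewrite gt_eqF.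
split=> //; first by rewrite divr_ge0 // ltW // exprn_gt0.
  by rewrite ler_pdivrMr ?exprn_gt0 // (_ : D / N * N ^+ 2 = D * N) //; field.
split; [|exact: divr_gt0| |by rewrite divr_gt0 // exprn_gt0|exact: D2].
  by rewrite ler_pdivrMr //; lra.
by rewrite ler_pdivrMr //; lra.
Qed.

Lemma loop_step D N Q s a : 1 <= D -> 1000 * D ^+ 2 <= N -> 0 <= Q -> Q <= D * N ->
  0 <= s -> 0 <= a ->
  a * (N ^+ 2 - 38 * D ^+ 2 * N) <= s * Q ->
  s * (Q - 32 * D ^+ 3) <= a * N ^+ 2 ->
  s * expR (- (Q / N ^+ 2 + 84 * D ^+ 3 / N ^+ 2)) <= s - a
    <= s * expR (- (Q / N ^+ 2 - 84 * D ^+ 3 / N ^+ 2)).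
Proof.
move=> D1 DN Q0 QN s0 a0 up lo.
have [N0 D0 q0 qD [DDN DN0 DN1 DDN0 D2]] := scale_bounds D1 DN Q0 QN.
have Nn : N != 0 by rewrite gt_eqF.
set q := Q / N ^+ 2 in q0 qD *.
set x := D / N in qD DN0 DN1; set y := D ^+ 2 / N in DDN DDN0.
have e1 : D ^+ 3 / N ^+ 2 = x * y by rewrite /x /y; field.
have x2 : x ^+ 2 <= x * y.
  by rewrite expr2 ler_pM2l // /x /y ler_pM2r ?invr_gt0.
have up' : a <= s * (q + 76 * (x * y)).
  have := @upper_step a s (N ^+ 2) Q (38 * y) a0 s0 (exprn_gt0 _ N0) Q0.
  move=> /(_ _ _ _)/le_trans; apply; [lra|lra| |].
    by rewrite (_ : 38 * y * N ^+ 2 = 38 * D ^+ 2 * N) // /y; field.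
  apply: ler_wpM2l => //; rewrite -/q.
  have : q * y <= x * y by rewrite ler_pM2r.
  by lra.
have lo' : s * (q - 76 * (x * y)) <= a.
  rewrite -(ler_pM2r (exprn_gt0 2 N0)); apply: le_trans lo.
  rewrite -[leLHS]mulrA; apply: ler_wpM2l => //.
  rewrite -e1 mulrBl /q divfK ?expf_neq0 // -mulrA divfK ?expf_neq0 //.
  have : 0 <= D ^+ 3 by rewrite exprn_ge0 // ltW.
  lra.
have xy1 : x * y <= x * (1 / 1000) by apply: ler_wpM2l; [exact: ltW | ].
have xy0 : 0 <= x * y by rewrite mulr_ge0 // ltW.
rewrite (_ : 84 * D ^+ 3 / N ^+ 2 = (76 + 8) * (x * y)); last by rewrite -e1; ring.
apply: avoid_step_error q0 qD DN1 xy0 _ x2 _ _ lo' up' => //; clear -xy1; lra.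
Qed.

Lemma double_step D N Q s a : 1 <= D -> 1000 * D ^+ 2 <= N -> 0 <= Q -> Q <= D * N ->
  0 <= s -> 0 <= a ->
  a * (N ^+ 4 - 164 * D ^+ 2 * N ^+ 3) <= s * Q ^+ 2 ->
  s * (Q ^+ 2 - 152 * D ^+ 3 * Q) <= a * N ^+ 4 ->
  s * expR (- ((Q / N ^+ 2) ^+ 2 + 336 * D ^+ 4 / N ^+ 3)) <= s - a
    <= s * expR (- ((Q / N ^+ 2) ^+ 2 - 336 * D ^+ 4 / N ^+ 3)).
Proof.
move=> D1 DN Q0 QN s0 a0 up lo.
have [N0 D0 q0 qD [DDN DN0 DN1 DDN0 D2]] := scale_bounds D1 DN Q0 QN.
have Nn : N != 0 by rewrite gt_eqF.
set q := Q / N ^+ 2 in q0 qD *.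
set x := D / N in qD DN0 DN1; set y := D ^+ 2 / N in DDN DDN0.
have e1 : D ^+ 4 / N ^+ 3 = x ^+ 2 * y by rewrite /x /y; field.
have q2 : Q ^+ 2 / N ^+ 4 = q ^+ 2 by rewrite /q; field.
have qx : q ^+ 2 <= x ^+ 2 by rewrite lerXn2r ?nnegrE // ltW.
have qq0 : 0 <= q ^+ 2 by rewrite sqr_ge0.
have x0 : 0 < x ^+ 2 by rewrite exprn_gt0.
have xy0 : 0 <= x ^+ 2 * y by rewrite mulr_ge0 // ltW.
have xy1 : x ^+ 2 * y <= x ^+ 2 * (1 / 1000) by apply: ler_wpM2l; [exact: ltW | ].
have x1 : x ^+ 2 <= 1 / 1000.
  have : x * x <= x * (1 / 1000) by apply: ler_wpM2l; [exact: ltW | ].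
  by rewrite -expr2; lra.
have x4 : x ^+ 2 * x ^+ 2 <= x ^+ 2 * y.
  rewrite ler_pM2l // /x /y expr_div_n.
  rewrite ler_wpM2l ?sqr_ge0 // lef_pV2 ?posrE ?exprn_gt0 //.
  have : 1 <= N by lra.
  move=> N1; rewrite expr2; have : N * 1 <= N * N by apply: ler_wpM2l; [exact: ltW|].
  by lra.
have up' : a <= s * (q ^+ 2 + 328 * (x ^+ 2 * y)).
  have := @upper_step a s (N ^+ 4) (Q ^+ 2) (164 * y) a0 s0 (exprn_gt0 _ N0) (sqr_ge0 _).
  move=> /(_ _ _ _)/le_trans; apply; [lra|lra| |].
    by rewrite (_ : 164 * y * N ^+ 4 = 164 * D ^+ 2 * N ^+ 3) // /y; field.
  apply: ler_wpM2l => //; rewrite q2.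
  have : q ^+ 2 * y <= x ^+ 2 * y by rewrite ler_pM2r.
  by lra.
have lo' : s * (q ^+ 2 - 328 * (x ^+ 2 * y)) <= a.
  rewrite -(ler_pM2r (exprn_gt0 4 N0)); apply: le_trans lo.
  rewrite -[leLHS]mulrA; apply: ler_wpM2l => //.
  rewrite -e1 mulrBl -q2 divfK ?expf_neq0 //.
  rewrite (_ : 328 * (D ^+ 4 / N ^+ 3) * N ^+ 4 = 328 * (D ^+ 3 * (D * N))); last by field.
  have : D ^+ 3 * Q <= D ^+ 3 * (D * N).
    by apply: ler_wpM2l => //; rewrite exprn_ge0 // ltW.
  have : 0 <= D ^+ 3 * Q by rewrite mulr_ge0 // exprn_ge0 // ltW.
  lra.
rewrite (_ : 336 * D ^+ 4 / N ^+ 3 = (328 + 8) * (x ^+ 2 * y)); last by rewrite -e1; ring.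
have x4' : (x ^+ 2) ^+ 2 <= x ^+ 2 * y by rewrite [leLHS]expr2.
apply: avoid_step_error qq0 qx x1 xy0 _ x4' _ _ lo' up' => //; clear -xy1; lra.
Qed.

Lemma iter_steps (X : Type) (f : seq X -> K) (l : seq X) x y :
  (forall b l', 0 <= f (b :: l')) ->
  0 <= f [::] ->
  (forall l1 b l2, l = l1 ++ b :: l2 ->
     f l2 * expR (- x) <= f (b :: l2) <= f l2 * expR (- y)) ->
  f [::] * expR (- ((size l)%:R * x)) <= f l <= f [::] * expR (- ((size l)%:R * y)).
Proof.
move=> fge f0; elim: l => [|b l IH] h /=.
  by rewrite !mul0r oppr0 expR0 !mulr1 lexx.
have /andP[l1 l2] :
    f [::] * expR (- ((size l)%:R * x)) <= f l <= f [::] * expR (- ((size l)%:R * y)).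
  by apply: IH => l1 b' l2 El; apply: (h (b :: l1)); rewrite El.
have /andP[h1 h2] := h [::] b l erefl.
have expS z : expR (- ((size l).+1%:R * z)) = expR (- ((size l)%:R * z)) * expR (- z).
  by rewrite -expRD; congr expR; rewrite -natr1; ring.
rewrite !expS !mulrA; apply/andP; split.
  by apply: le_trans h1; rewrite ler_wpM2r ?expR_ge0.
by apply: (le_trans h2); rewrite ler_wpM2r ?expR_ge0.
Qed.

End Steps.

Section Iterate.
Variables (K : realType) (U V : finType) (m : U -> U) (E : rel U)
  (a : V -> nat) (d : nat).
Hypotheses (mK : involutive m) (E_sym : symmetric E) (E_irr : irreflexive E)
  (d_gt0 : (0 < d)%N) (a_le : forall v, (a v <= d)%N)
  (E_le : forall u, (#|[set v | E u v]| <= d)%N)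
  (a_sum : (\sum_v a v)%N = #|U|) (dN : (1000 * d ^ 2 <= #|U|)%N).

Let none : rel U := fun _ _ => false.
Let N : K := #|U|%:R.
Let D : K := d%:R.
Let Q : K := (num_pairs a)%:R.
Let q := Q / N ^+ 2.

Let D1 : 1 <= D. Proof. by rewrite ler1n. Qed.
Let DN : 1000 * D ^+ 2 <= N.
Proof. by rewrite /D /N -natrX -natrM ler_nat. Qed.
Let Q0 : 0 <= Q. Proof. exact: ler0n. Qed.
Let QN : Q <= D * N.
Proof.
rewrite /Q /D /N -natrM ler_nat -a_sum big_distrr /=; apply: leq_sum => v _.
by rewrite mulnC leq_mul2r; apply/orP; right; move: (a_le v); lia.
Qed.

Let natB38 : (N ^+ 2 - 38 * D ^+ 2 * N) = (#|U| ^ 2 - 38 * d ^ 2 * #|U|)%N%:R.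
Proof.
rewrite natrB ?natrM ?natrX ?natrM ?natrX //.
by rewrite -[(#|U| ^ 2)%N]mulnn leq_mul2r; apply/orP; right; move: dN; lia.
Qed.

Let natB164 : (N ^+ 4 - 164 * D ^+ 2 * N ^+ 3) = (#|U| ^ 4 - 164 * d ^ 2 * #|U| ^ 3)%N%:R.
Proof.
rewrite natrB ?natrM ?natrX ?natrM ?natrX //.
by rewrite [(#|U| ^ 4)%N]expnS leq_mul2r; apply/orP; right; move: dN; lia.
Qed.

Lemma loops_count (l : seq (U * U)) : uniq l -> antisym_list l ->
  (forall p q, (p, q) \in l -> E p q) ->
  #|assignments U a|%:R * expR (- ((size l)%:R * (q + 84 * D ^+ 3 / N ^+ 2)))
    <= (#|good_assignments m a (unordered_rel l) none|%:R : K)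
    <= #|assignments U a|%:R * expR (- ((size l)%:R * (q - 84 * D ^+ 3 / N ^+ 2))).
Proof.
move=> l_uniq l_anti lE.
pose f (l : seq (U * U)) : K := #|good_assignments m a (unordered_rel l) none|%:R.
have -> : #|assignments U a|%:R = f [::].
  congr _%:R; apply: eq_card => rho; rewrite [RHS]in_set.
  have av1 : avoid1 (unordered_rel [::]) rho by apply/avoid1P.
  have av2 : avoid2 m none rho by apply/avoid2P.
  by rewrite av1 av2 !andbT.
apply: (iter_steps (f := f)) => [b l'||l1 [u1 u2] l2 lE']; [exact: ler0n..|].
set S := good_assignments m a (unordered_rel l2) none.
pose A := [set rho : {ffun U -> V} in S | rho u1 == rho u2].
have El2 p r : unordered_rel l2 p r -> E p r.
  by case/orP => h; [|rewrite E_sym]; apply: lE; rewrite lE' mem_cat inE h !orbT.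
have Eu : E u1 u2 by apply: lE; rewrite lE' mem_cat inE eqxx orbT.
have u12 : u1 != u2 by apply/eqP => e; rewrite e E_irr in Eu.
have new : ~~ unordered_rel l2 u1 u2.
  apply/norP; split.
    by move: l_uniq; rewrite lE' cat_uniq => /and3P[_ _ /andP[]].
  have : (u2, u1) \notin l by apply: l_anti; rewrite lE' mem_cat inE eqxx orbT.
  by rewrite lE' mem_cat inE !negb_or => /and3P[].
have r_sym : symmetric (unordered_rel l2) by move=> p r; rewrite /unordered_rel orbC.
have -> : f ((u1, u2) :: l2) = f l2 - #|A|%:R.
  apply/eqP; rewrite eq_sym subr_eq -natrD /f; apply/eqP; congr _%:R.
  rewrite -(cardsID [set rho : {ffun U -> V} | rho u1 == rho u2] S) addnC; congr (_ + _)%N.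
    apply: eq_card => rho; apply/idP/idP => [/setDP[]|] /good_assignmentsP[rA /avoid1P av av2].
      rewrite in_set => n12; apply/good_assignmentsP; split=> //; apply/avoid1P => p r.
      rewrite /unordered_rel !in_cons => /orP[/orP[/eqP[-> ->]|h]|/orP[/eqP[-> ->]|h]].
      - exact/eqP.
      - by apply: av; rewrite /unordered_rel h.
      - by apply/eqP; rewrite eq_sym.
      - by apply: av; rewrite /unordered_rel h orbT.
    apply/setDP; split; last by rewrite in_set; apply/eqP/av; rewrite /unordered_rel mem_head.
    apply/good_assignmentsP; split=> //; apply/avoid1P => p r.
    by rewrite /unordered_rel => /orP[h|h]; apply: av; rewrite /unordered_rel !in_cons h !orbT.
  by apply: eq_card => rho; rewrite !inE.
apply: (loop_step D1 DN Q0 QN); rewrite ?ler0n //.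
  rewrite natB38 -!natrM ler_nat.
  exact: (loop_upper mK E_sym d_gt0 a_le E_le r_sym El2 u12 new).
rewrite -!natrX -!natrM.
have := loop_lower mK E_sym d_gt0 a_le E_le r_sym El2 u12 new.
rewrite -(ler_nat K) !natrM; apply: le_trans; apply: ler_wpM2l; first exact: ler0n.
rewrite lerBlDr -?natrX -!natrM -natrD ler_nat (_ : (d * (d * d) = d ^ 3)%N);
  [by rewrite addnC -leq_subLR ?mulnn | by rewrite !expnS muln1].
Qed.

Lemma double_count_bounds (l : seq (U * U)) : uniq l -> antisym_list l ->
  (forall p q, (p, q) \in l ->
     [/\ uniq [:: p; q; m p; m q], (m p, m q) \notin l & (m q, m p) \notin l]) ->
  (forall p q, (p, q) \in l -> [/\ E p (m p), E q (m q), ~~ E p q & ~~ E (m p) (m q)]) ->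
  #|good_assignments m a E none|%:R * expR (- ((size l)%:R * (q ^+ 2 + 336 * D ^+ 4 / N ^+ 3)))
    <= (#|good_assignments m a E (mated_rel m l)|%:R : K)
    <= #|good_assignments m a E none|%:R * expR (- ((size l)%:R *
         (q ^+ 2 - 336 * D ^+ 4 / N ^+ 3))).
Proof.
move=> l_uniq l_anti lm lE.
pose f (l : seq (U * U)) : K := #|good_assignments m a E (mated_rel m l)|%:R.
have -> : #|good_assignments m a E none|%:R = f [::] by [].
apply: (iter_steps (f := f)) => [b l'||l1 [u1 u3] l2 lE']; [exact: ler0n..|].
set S := good_assignments m a E (mated_rel m l2).
pose A := [set rho : {ffun U -> V} in S | (rho u1 == rho u3) && (rho (m u1) == rho (m u3))].
have inl p r : (p, r) \in l2 -> (p, r) \in l.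
  by move=> h; rewrite lE' mem_cat inE h !orbT.
have uin : (u1, u3) \in l by rewrite lE' mem_cat inE eqxx orbT.
have [un n1 n2] := lm _ _ uin; have [Eu1 Eu3 nE1 nE2] := lE _ _ uin.
have r_sym : symmetric (mated_rel m l2).
  move=> p r; rewrite /mated_rel /unordered_rel orbC (orbC (_ \in _)) [X in _ || X]orbC.
  by rewrite (orbC (unordered_rel _ _ _)) /unordered_rel orbC.
have r_m p r : mated_rel m l2 p r -> mated_rel m l2 (m p) (m r) by rewrite /mated_rel !mK orbC.
have r_E p r : mated_rel m l2 p r -> E p (m p).
  rewrite /mated_rel /unordered_rel => /orP[]/orP[]/inl/lE[] // h1 h2 _ _;
    move: h1 h2; rewrite ?mK => h1 h2.
    by rewrite E_sym.
  by rewrite E_sym.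
have new : ~~ mated_rel m l2 u1 u3.
  rewrite /mated_rel /unordered_rel !negb_or; apply/andP; split; apply/andP; split.
  - by move: l_uniq; rewrite lE' cat_uniq => /and3P[_ _ /andP[]].
  - by have := l_anti _ _ uin; apply: contra; apply: inl.
  - by apply: contra n1; apply: inl.
  - by apply: contra n2; apply: inl.
have -> : f ((u1, u3) :: l2) = f l2 - #|A|%:R.
  apply/eqP; rewrite eq_sym subr_eq -natrD /f; apply/eqP; congr _%:R.
  rewrite -(cardsID [set rho : {ffun U -> V} | (rho u1 == rho u3) && (rho (m u1) == rho (m u3))] S)
    addnC; congr (_ + _)%N.
    apply: eq_card => rho; apply/idP/idP => [/setDP[]|] /good_assignmentsP[rA av1 /avoid2P av].
      rewrite in_set => n12; apply/good_assignmentsP; split=> //; apply/avoid2P => p r.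
      rewrite /mated_rel /unordered_rel !in_cons => /orP[]/orP[]/orP[/eqP[]|h].
      - by move=> -> -> e1 e2; rewrite e1 e2 !eqxx in n12.
      - by apply: av; rewrite /mated_rel /unordered_rel h.
      - by move=> -> -> e1 e2; rewrite e1 e2 !eqxx in n12.
      - by apply: av; rewrite /mated_rel /unordered_rel h orbT.
      - by move=> h1 h2 e1 e2; rewrite -h1 -h2 !mK e1 e2 !eqxx in n12.
      - by apply: av; rewrite /mated_rel /unordered_rel h !orbT.
      - by move=> h1 h2 e1 e2; rewrite -h1 -h2 !mK e1 e2 !eqxx in n12.
      - by apply: av; rewrite /mated_rel /unordered_rel h !orbT.
    apply/setDP; split.
      apply/good_assignmentsP; split=> //; apply/avoid2P => p r.
      rewrite /mated_rel /unordered_rel => /orP[]/orP[] h;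
        by apply: av; rewrite /mated_rel /unordered_rel !in_cons h !orbT.
    rewrite in_set; apply/negP => /andP[/eqP e1 /eqP e2]; apply: (av u1 u3) => //.
    by rewrite /mated_rel /unordered_rel mem_head.
  by apply: eq_card => rho; rewrite !inE.
apply: (double_step D1 DN Q0 QN); rewrite ?ler0n //.
  rewrite natB164 -!natrX -!natrM ler_nat.
  exact: (double_upper mK E_sym d_gt0 a_le E_le E_sym (fun _ _ h => h) r_sym r_m r_E
    nE1 nE2 new un).
rewrite -!natrX -!natrM.
have := double_lower mK E_sym d_gt0 a_le E_le E_sym (fun _ _ h => h) r_sym r_m r_E nE1 nE2 new un.
rewrite -(ler_nat K) !natrM; apply: le_trans; apply: ler_wpM2l; first exact: ler0n.
rewrite lerBlDr -?natrX -!natrM -natrD ler_nat (_ : (d * (d * d) = d ^ 3)%N);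
  [by rewrite addnC -leq_subLR ?mulnn | by rewrite !expnS muln1].
Qed.

End Iterate.

(** * Asymptotic formula *)

Section Assembly.
Variables (K : realType) (n : nat) (L R : {set 'I_n}) (d : 'I_n -> nat) (k : nat).
Hypotheses (LR : bipartition L R) (MLR : (M1 d R = M1 d L + k.*2)%N).

Let P := slot L d k.
Let mt := @mate n L d k.
Let E := @same_vertex n L d k.
Let omega := assignments P (deg_in d R).
Let good := good_assignments mt (deg_in d R) E (mated_rel mt (double_events L d k)).

Lemma prod_fact_split :
  (\prod_i (d i)`! = (\prod_i (deg_in d L i)`!) * (\prod_i (deg_in d R i)`!))%N.
Proof.
rewrite -big_split; apply: eq_bigr => v _ /=; rewrite /deg_in.
have [vL|/(coverLR LR) vR] := boolP (v \in L).
  by case: ifP => [/(disjLR LR vL)//|_]; rewrite muln1.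
by rewrite vR mul1n.
Qed.

Lemma sum_deg_in_slot : (\sum_v deg_in d R v)%N = #|P|.
Proof. by rewrite sum_deg_in (card_slot MLR). Qed.

Lemma card_omega : (#|omega| * \prod_i (deg_in d R i)`! = (M1 d R)`!)%N.
Proof. by rewrite card_assignments ?sum_deg_in_slot // (card_slot MLR). Qed.

Lemma card_omega_gt0 : (0 < #|omega|)%N.
Proof. by have := fact_gt0 (M1 d R); rewrite -card_omega muln_gt0 => /andP[]. Qed.

Lemma num_Bgraphs_ratio : RR_edges L R d = k ->
  (num_Bgraphs L R d)%:R = main_term K L R d *
    (#|good|%:R / (#|omega|%:R * expR (- mu0 K L R d - mu1 K L R d - mu2 K L R d))).
Proof.
move=> kE; rewrite /main_term kE -card_omega.
have -> : #|good| = _ := card_good LR MLR.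
have -> : \prod_i (d i)`!%:R =
    (\prod_i (deg_in d L i)`!)%N%:R * (\prod_i (deg_in d R i)`!)%N%:R :> K.
  by rewrite -natrM -prod_fact_split natr_prod.
have h1 : (\prod_i (deg_in d L i)`!)%N%:R != 0 :> K.
  by rewrite pnatr_eq0 -lt0n prodn_gt0 // => i; exact: fact_gt0.
have h2 : (\prod_i (deg_in d R i)`!)%N%:R != 0 :> K.
  by rewrite pnatr_eq0 -lt0n prodn_gt0 // => i; exact: fact_gt0.
have h3 : k`!%:R != 0 :> K by rewrite pnatr_eq0 -lt0n fact_gt0.
have h4 : #|omega|%:R != 0 :> K by rewrite pnatr_eq0 -lt0n card_omega_gt0.
have h5 : 2 ^+ k != 0 :> K by rewrite expf_neq0.
have h6 : expR (- mu0 K L R d - mu1 K L R d - mu2 K L R d) != 0 by rewrite gt_eqF ?expR_gt0.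
have alg (e t f o g x y : K) : x != 0 -> y != 0 -> f != 0 -> o != 0 -> t != 0 -> e != 0 ->
    g = o * y * e / (t * f * (x * y)) * (g * (x * (f * t)) / (o * e)).
  by move=> *; field; do ?[apply/andP; split].
by rewrite !natrM natrX; exact: alg h1 h2 h3 h4 h5 h6.
Qed.

Lemma loop_events_rel p q : unordered_rel (loop_events L d k) p q = E p q.
Proof.
rewrite /unordered_rel !mem_loop_events (same_vertex_sym q p) -andb_orr -neq_ltn.
rewrite (inj_eq val_inj) (inj_eq enum_rank_inj).
by case: eqP => [->|]; rewrite ?andbT //= /E same_vertex_irr.
Qed.

Lemma good_loops (a : 'I_n -> nat) none :
  good_assignments mt a (unordered_rel (loop_events L d k)) none = good_assignments mt a E none.
Proof.
apply/setP => rho; apply/good_assignmentsP/good_assignmentsP => -[h1 /avoid1P h2 h3];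
  split=> //; apply/avoid1P => p q; [rewrite -loop_events_rel|rewrite loop_events_rel]; exact: h2.
Qed.

Section Bounds.
Variable D : nat.
Hypotheses (D_gt0 : (0 < D)%N) (d_le : forall i, (d i <= D)%N)
  (D_small : (1000 * D ^ 4 <= M1 d R)%N).

Let N : K := (M1 d R)%:R.
Let q : K := (M2 d R)%:R / N ^+ 2.

Let restrict_le (S : {set 'I_n}) v : (deg_in d S v <= D)%N.
Proof. by rewrite /deg_in; case: ifP. Qed.

Let M2_restrict (S : {set 'I_n}) : (\sum_v deg_in d S v * (deg_in d S v - 1) = M2 d S)%N.
Proof.
rewrite /M2 [RHS]big_mkcond; apply: eq_bigr => v _.
by rewrite /deg_in; case: ifP.
Qed.

Let M2_le (S : {set 'I_n}) : (M2 d S <= D * M1 d S)%N.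
Proof.
rewrite /M2 /M1 big_distrr /=; apply: leq_sum => v _.
by rewrite mulnC leq_mul2r; apply/orP; right; move: (d_le v); lia.
Qed.

Let n1 := size (loop_events L d k).

Let n1E : (n1.*2 = M2 d L + k.*2)%N.
Proof. by rewrite size_loop_events M2_restrict. Qed.

Lemma good_bounds :
  #|omega|%:R * expR (- (n1%:R * (q + 84 * D%:R ^+ 3 / N ^+ 2)
    + (k * (k - 1))%N%:R * (q ^+ 2 + 336 * D%:R ^+ 4 / N ^+ 3)))
  <= (#|good|%:R : K) <=
  #|omega|%:R * expR (- (n1%:R * (q - 84 * D%:R ^+ 3 / N ^+ 2)
    + (k * (k - 1))%N%:R * (q ^+ 2 - 336 * D%:R ^+ 4 / N ^+ 3))).
Proof.
have E_le u : (#|[set v | E u v]| <= D)%N.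
  rewrite same_vertex_card; case: u => [x|_] //.
  by apply: leq_trans (restrict_le L (tag x)); apply: leq_subr.
have DN : (1000 * D ^ 2 <= #|P|)%N.
  rewrite (card_slot MLR); apply: leq_trans D_small.
  by rewrite leq_mul2l leq_pexp2l.
have /andP[l1 l2] := loops_count K (@mateK n L d k) (@same_vertex_sym n L d k)
  (@same_vertex_irr n L d k) D_gt0 (restrict_le R) E_le sum_deg_in_slot DN
  (loop_events_uniq L d k) (@loop_events_anti n L d k)
  (fun p r h => proj1 (andP (etrans (esym (mem_loop_events p r)) h))).
have /andP[d1 d2] := double_count_bounds K (@mateK n L d k) (@same_vertex_sym n L d k)
  D_gt0 (restrict_le R) E_le sum_deg_in_slot DN
  (double_events_uniq L d k) (@double_events_anti n L d k) (@double_events_distinct n L d k)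
  (@double_events_same_vertex n L d k).
move: l1 l2 d1 d2; rewrite good_loops size_double_events /num_pairs M2_restrict (card_slot MLR).
rewrite -/n1 -/N -/q => l1 l2 d1 d2.
have expD (x y : K) : expR (- (x + y)) = expR (- x) * expR (- y) by rewrite opprD expRD.
rewrite !expD; apply/andP; split.
  by apply: le_trans d1; rewrite [leLHS]mulrA ler_wpM2r ?expR_ge0.
by apply: (le_trans d2); rewrite [leRHS]mulrA ler_wpM2r ?expR_ge0.
Qed.

Let tau : K := 421 * D%:R ^+ 4 / N.

Lemma ratio_bounds :
  expR (- tau)
  <= #|good|%:R / (#|omega|%:R * expR (- mu0 K L R d - mu1 K L R d - mu2 K L R d))
  <= expR tau.
Proof.
have D1 : 1 <= D%:R :> K by rewrite ler1n.
have D0 : 0 < D%:R :> K by rewrite ltr0n.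
have N0 : 0 < N.
  by rewrite ltr0n; apply: leq_trans D_small; rewrite muln_gt0 expn_gt0 D_gt0.
have Nn : N != 0 by rewrite gt_eqF.
have MR : (M2 d R)%:R <= D%:R * N by rewrite -natrM ler_nat M2_le.
have q0 : 0 <= q by rewrite divr_ge0 // ?exprn_ge0 // ltW.
have qD : q <= D%:R / N.
  by rewrite ler_pdivrMr ?exprn_gt0 // (_ : D%:R / N * N ^+ 2 = D%:R * N) //; field.
have kN : k%:R <= N by rewrite ler_nat MLR; lia.
have n1N : n1%:R <= D%:R * N.
  rewrite -natrM ler_nat; have := M2_le L; move: n1E MLR D_gt0.
  move: (M1 d R) (M1 d L) (M2 d L) => a b c; nia.
have e1 : mu0 K L R d = k%:R * q.
  rewrite /mu0 -natrB; last by rewrite MLR leq_addr.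
  rewrite (_ : (M1 d R - M1 d L = k.*2)%N); last by rewrite MLR addKn.
  rewrite -mul2n natrM /q -/N; field; exact: Nn.
have e2 : mu0 K L R d + mu1 K L R d = n1%:R * q.
  rewrite e1 /mu1 /q -/N; have h : n1%:R * 2 = (M2 d L)%:R + k%:R * 2 :> K.
    by rewrite -!natrM -natrD !muln2 n1E.
  have -> : (M2 d L)%:R = n1%:R * 2 - k%:R * 2 :> K by rewrite h addrK.
  field; exact: Nn.
have e3 : (k * (k - 1))%N%:R = k%:R ^+ 2 - k%:R :> K.
  case: (k) => [|j]; first by rewrite mul0n expr0n subr0.
  by rewrite subn1 /= natrM -natr1; ring.
have k2 : k%:R ^+ 2 - k%:R <= N ^+ 2 :> K.
  by have : k%:R ^+ 2 <= N ^+ 2 by [rewrite lerXn2r ?nnegrE // ltW]; have := ler0n K k; lra.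
have k2' : 0 <= k%:R ^+ 2 - k%:R :> K by rewrite -e3 ler0n.
have b1 : n1%:R * (84 * D%:R ^+ 3 / N ^+ 2) <= 84 * (D%:R ^+ 4 / N).
  rewrite (_ : 84 * (D%:R ^+ 4 / N) = D%:R * N * (84 * D%:R ^+ 3 / N ^+ 2)); last by field.
  by rewrite ler_wpM2r // divr_ge0 ?mulr_ge0 ?ler0n ?exprn_ge0 // ltW.
have b2 : (k%:R ^+ 2 - k%:R) * (336 * D%:R ^+ 4 / N ^+ 3) <= 336 * (D%:R ^+ 4 / N).
  rewrite (_ : 336 * (D%:R ^+ 4 / N) = N ^+ 2 * (336 * D%:R ^+ 4 / N ^+ 3)); last by field.
  by rewrite ler_wpM2r // divr_ge0 ?mulr_ge0 ?ler0n ?exprn_ge0 // ltW.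
have b3 : k%:R * q ^+ 2 <= D%:R ^+ 4 / N.
  apply: le_trans (_ : N * (D%:R / N) ^+ 2 <= _).
    by apply: ler_pM; rewrite ?sqr_ge0 // lerXn2r ?nnegrE // divr_ge0 // ltW.
  rewrite (_ : N * (D%:R / N) ^+ 2 = D%:R ^+ 2 / N); last by field.
  by apply: ler_wpM2r; [rewrite invr_ge0 ltW | exact: ler_weXn2l].
have b4 : 0 <= k%:R * q ^+ 2 by rewrite mulr_ge0 // sqr_ge0.
have tauE : tau = 421 * (D%:R ^+ 4 / N) by rewrite /tau mulrA.
have muE : - mu0 K L R d - mu1 K L R d - mu2 K L R d = - (n1%:R * q) - k%:R ^+ 2 * q ^+ 2.
  by rewrite /mu2 {2}e1 -e2; ring.
have o0 : 0 < #|omega|%:R :> K by rewrite ltr0n card_omega_gt0.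
have /andP[g1 g2] := good_bounds; rewrite e3 in g1 g2.
rewrite muE ler_pdivlMr ?mulr_gt0 ?expR_gt0 // ler_pdivrMr ?mulr_gt0 ?expR_gt0 //.
apply/andP; split.
  apply: le_trans g1; rewrite [leLHS]mulrCA -expRD; apply: ler_wpM2l; first exact: ltW.
  by rewrite ler_expR tauE; lra.
apply: (le_trans g2); rewrite [leRHS]mulrCA -expRD; apply: ler_wpM2l; first exact: ltW.
by rewrite ler_expR tauE; lra.
Qed.

End Bounds.
End Assembly.

Lemma RR_edgesP {n : nat} {L R : {set 'I_n}} {d : 'I_n -> nat} :
  bipartition L R -> ~~ odd (M d) -> (M1 d L <= M1 d R)%N ->
  M1 d R = (M1 d L + (RR_edges L R d).*2)%N.
Proof.
move=> LR; rewrite (M_split d LR) oddD => ev le; rewrite /RR_edges divn2 even_halfK ?subnKC //.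
by rewrite oddB // addbC.
Qed.

Lemma expR_near1 {K : realType} {t x : K} : 0 <= t -> t <= 1 / 2 ->
  expR (- t) <= x <= expR t -> `|x - 1| <= 2 * t.
Proof.
move=> t0 t1 /andP[lo up]; rewrite ler_norml; apply/andP; split.
  by have := expR_ge1Dx (- t); lra.
have e1 : 1 - t <= expR (- t) by exact: expR_ge1Dx.
have e2 : expR t <= (1 - t)^-1.
  rewrite -[leLHS]invrK -expRN lef_pV2 ?posrE ?expR_gt0 //; lra.
have e3 : (1 - t)^-1 <= 1 + 2 * t.
  rewrite -[leLHS]mul1r ler_pdivrMr; [nra|lra].
by lra.
Qed.

Lemma num_Bgraphs_estimate (K : realType) (n : nat) (L R : {set 'I_n}) (d : 'I_n -> nat) :
  bipartition L R -> ~~ odd (M d) -> (M1 d L <= M1 d R)%N ->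
  (2000 * dmax d ^ 4 <= M d)%N ->
  exists delta : K,
    `|delta| <= 1684 * ((dmax d)%:R ^+ 4 / (M d)%:R) /\
    (num_Bgraphs L R d)%:R = main_term K L R d * (1 + delta).
Proof.
move=> LR ev le small; have MLR := RR_edgesP LR ev le.
have MS := M_split d LR.
have := num_Bgraphs_ratio K LR MLR erefl; set r := (X in main_term _ _ _ _ * X) => ->.
exists (r - 1); split; last by rewrite [1 + _]addrC subrK.
have d_le i : (d i <= dmax d)%N by exact: leq_bigmax.
have [D0|D_gt0] := posnP (dmax d); last first.
  have RN : (1000 * dmax d ^ 4 <= M1 d R)%N by lia.
  have Npos : (0 < M1 d R)%N by apply: leq_trans RN; rewrite muln_gt0 expn_gt0 D_gt0.
  have N0 : 0 < (M1 d R)%:R :> K by rewrite ltr0n.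
  have D4 : 0 <= (dmax d)%:R ^+ 4 :> K by rewrite exprn_ge0.
  have RN' : 1000 * (dmax d)%:R ^+ 4 <= (M1 d R)%:R :> K.
    by rewrite -natrX -natrM ler_nat.
  have t0 : 0 <= 421 * (dmax d)%:R ^+ 4 / (M1 d R)%:R :> K.
    by apply: divr_ge0; [rewrite mulr_ge0 ?ler0n | exact: ltW].
  have t1 : 421 * (dmax d)%:R ^+ 4 / (M1 d R)%:R <= 1 / 2 :> K.
    by rewrite ler_pdivrMr //; lra.
  apply: le_trans (expR_near1 t0 t1 (ratio_bounds K LR MLR D_gt0 d_le RN)) _.
  have M0 : 0 < (M d)%:R :> K by rewrite ltr0n MS; lia.
  have MN : (M d)%:R <= 2 * (M1 d R)%:R :> K by rewrite -natrM ler_nat MS; lia.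
  have invMN : (M1 d R)%:R^-1 <= 2 * (M d)%:R^-1 :> K.
    by rewrite -[leLHS]mul1r ler_pdivrMr // mulrAC ler_pdivlMr // mul1r.
  have := ler_wpM2l D4 invMN; move: (_^-1) (_^-1) => x y h; lra.
have d0 i : d i = 0%N by have := d_le i; rewrite D0; lia.
have M10 S : M1 d S = 0%N by rewrite /M1 big1.
rewrite D0 expr0n mul0r mulr0 normr_le0 subr_eq0 /r.
have -> : mu2 K L R d = 0 by rewrite /mu2 /mu0 !M10 subrr !mul0r expr0n.
have -> : mu1 K L R d = 0 by rewrite /mu1 !M10 expr0n mulr0 invr0 mulr0.
have -> : mu0 K L R d = 0 by rewrite /mu0 !M10 subrr !mul0r.
rewrite oppr0 !addr0 expR0 mulr1.
set X := good_assignments _ _ _ _; set Y := assignments _ _.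
have -> : X = Y.
  apply/setP => rho; apply/good_assignmentsP/idP => [[]//|rA].
  have no (u : slot L d (RR_edges L R d)) : False.
    have : (0 < #|{: slot L d (RR_edges L R d)}|)%N by apply/card_gt0P; exists u.
    by rewrite (card_slot MLR) M10.
  by split=> //; [apply/avoid1P|apply/avoid2P] => p; case: (no p).
by rewrite divff // pnatr_eq0 -lt0n (card_omega_gt0 MLR).
Qed.

Local Open Scope classical_set_scope.
Local Open Scope ring_scope.

Theorem theorem2p1 (K : realType) (eps : nat -> K)
    (eps_to_0 : eps @ \oo --> (0 : K)) :
  exists C : K, \forall n \near \oo,
    forall (L R : {set 'I_n}) (d : 'I_n -> nat),
      bipartition L R ->
      ~~ odd (\sum_(i < n) d i)%N ->
      (dmax d)%:R <= eps n * (M d)%:R `^ (1 / 4) ->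
      (M1 d L <= M1 d R)%N ->
      exists delta : K,
        `|delta| <= C * ((dmax d)%:R ^+ 4 / (M d)%:R) /\
        (num_Bgraphs L R d)%:R = main_term K L R d * (1 + delta).
Proof.
exists 1684; have e10 : (0 : K) < 1 / 10 by lra.
near=> n => L R d LR ev dle le.
have eps_le : `|eps n| <= 1 / 10 by near: n; exact: cvgr0_norm_le eps_to_0 _ e10.
apply: num_Bgraphs_estimate => //.
rewrite -(ler_nat K) natrM natrX.
have root4 : ((M d)%:R `^ (1 / 4)) ^+ 4 = (M d)%:R :> K.
  by rewrite -powR_mulrn ?powR_ge0 // -powRrM mul1r mulVf // powRr1.
have dle' : (dmax d)%:R <= 1 / 10 * (M d)%:R `^ (1 / 4) :> K.
  apply: le_trans dle _; rewrite ler_wpM2r ?powR_ge0 //.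
  by apply: le_trans (ler_norm _) eps_le.
have : (dmax d)%:R ^+ 4 <= (1 / 10 * (M d)%:R `^ (1 / 4)) ^+ 4 :> K.
  by rewrite lerXn2r ?nnegrE ?mulr_ge0 ?powR_ge0 // ltW.
rewrite exprMn root4; have := ler0n K (M d).
move: ((M d)%:R) ((dmax d)%:R ^+ 4) => x y; lra.
Unshelve. all: by end_near.
Qed.
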